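(* Let $K$ be a field with $\operatorname{char} K = 2$ and let $(V,Q)$ be a nondefective quadratic space of finite dimension over $K$. (1) Suppose $\dim V \ge 4$. Then the special orthogonal group $\mathrm{SO}(V)$ is bireflectional if and only if $\dim V \equiv 0 \mod 4$. (2) Suppose $\dim V \equiv 2 \mod 4$ and let $\varphi \in \mathrm{SO}(V)$. Then $\varphi$ is bireflectional (in $\mathrm{SO}(V)$) if and only if $\varphi$ has a unipotent orthogonal summand $\psi$ such that (a) $\psi$ is cyclic, or (b) $\psi$ is orthogonally indecomposable and $\dim \psi \equiv 2 \mod 4$.
   Context: $Q$ is a quadratic form on the finite-dimensional $K$-vector space $V$, with associated bilinear form $f_Q(u,w)=Q(u+w)-Q(u)-Q(w)$; $Q$ is nondefective if $f_Q$ is nondegenerate. A subspace is nondefective if the restriction of $f_Q$ to it is nondegenerate. $\mathrm{O}(V)=\mathrm{O}(V,Q)$ is the orthogonal group, and $\mathrm{SO}(V)=\mathrm{SO}(V,Q)$ is the subgroup of all $\varphi\in \mathrm{O}(V)$ such that the dimension of the image of $\varphi-1$ is even. An involution is an element $\sigma$ with $\sigma^2=1$ (the identity is allowed). An element of a group $G$ is bireflectional if it is a product of 2 involutions of $G$; a group is bireflectional if all its elements are. An orthogonal summand of $\varphi\in \mathrm{O}(V)$ is the restriction $\psi=\varphi|_W$ to a nonzero nondefective $\varphi$-invariant subspace $W$ (so $V=W\perp W^\perp$ with both parts $\varphi$-invariant); $\dim\psi$ means $\dim W$. $\varphi$ is orthogonally indecomposable if $V\neq 0$ has no proper nonzero nondefective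 $\varphi$-invariant subspace (and similarly for $\psi$ on $W$). A transformation is cyclic if the space is generated by a single vector under its powers; it is unipotent if its difference with the identity is nilpotent. *)

(* Defs.v *)
From HB Require Import structures.
From mathcomp Require Import all_boot all_algebra.

Set Implicit Arguments.
Unset Strict Implicit.
Unset Printing Implicit Defensive.

Import GRing.Theory.
Local Open Scope ring_scope.

Section QuadraticForms.

Variables (K : fieldType) (V : vectType K).

Definition polar (q : V -> K) (u w : V) : K := q (u + w) - q u - q w.

Record quadform := QuadForm {
  qform :> V -> K;
  quadZ : forall (a : K) (u : V), qform (a *: u) = a ^+ 2 * qform u;
  polar_linearl : forall w, scalar (polar qform ^~ w);
  polar_linearr : forall u, scalar (polar qform u) }.

Fact polarC (q : V -> K) (u w : V) : polar q u w = polar q w u.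
Proof. by rewrite /polar [u + w]addrC addrAC. Qed.

Definition qpolar (Q : quadform) : V -> V -> K := polar Q.

Fact qpolar_bilinear (Q : quadform) :
  bilinear_for (GRing.Scale.Law.clone _ _ *%R _)
    (GRing.Scale.Law.clone _ _ (idfun \; *%R) _) (qpolar Q).
Proof. by split; [exact: polar_linearl | exact: polar_linearr]. Qed.

HB.instance Definition _ (Q : quadform) :=
  bilinear_isBilinear.Build K V V K
    (GRing.Scale.Law.clone _ _ *%R _)
    (GRing.Scale.Law.clone _ _ (idfun \; *%R) _)
    (qpolar Q) (qpolar_bilinear Q).

Fact qpolar_sym (Q : quadform) (u w : V) :
  qpolar Q u w = (-1) ^+ false * idfun (qpolar Q w u).
Proof. by rewrite mul1r /qpolar polarC. Qed.

HB.instance Definition _ (Q : quadform) :=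
  isHermitianSesquilinear.Build K V false idfun (qpolar Q) (qpolar_sym Q).

Definition nondefective (Q : quadform) : bool :=
  nondegenerate (qpolar Q : {symmetric V}).

(* Invertibility is required explicitly; it only matters when Q is
   defective. *)
Definition orthogonal_group (Q : quadform) (phi : 'End(V)) : Prop :=
  lker phi == 0%VS /\ forall u, Q (phi u) = Q u.

Definition special_orthogonal_group (Q : quadform) (phi : 'End(V)) : Prop :=
  orthogonal_group Q phi /\ ~~ odd (\dim (limg (phi - \1)%VF)).

(* A group of linear transformations is represented by its membership
   predicate; the identity counts as an involution. *)
Definition involution (sigma : 'End(V)) : Prop := (sigma \o sigma = \1)%VF.

Definition bireflectional_in (G : 'End(V) -> Prop) (phi : 'End(V)) : Prop :=
  exists sigma tau : 'End(V),
    [/\ G sigma, involution sigma, G tau, involution tau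
      & phi = (sigma \o tau)%VF].

Definition bireflectional (G : 'End(V) -> Prop) : Prop :=
  forall phi, G phi -> bireflectional_in G phi.

Definition invariant_subspace (phi : 'End(V)) (W : {vspace V}) : bool :=
  (phi @: W <= W)%VS.

Definition unipotent (phi : 'End(V)) : Prop :=
  exists n, forall u, iter n (phi - \1)%VF u = 0.

Definition cyclic_transformation (phi : 'End(V)) : Prop :=
  exists v, forall u, exists n,
    u \in <<[seq iter i phi v | i <- iota 0 n]>>%VS.

End QuadraticForms.

Section Restriction.

Variables (K : fieldType) (V : vectType K).
Implicit Types (Q : quadform V) (phi : 'End(V)) (W : {vspace V}).

Fact res_quadZ Q W (a : K) (u : subvs_of W) :
  Q (vsval (a *: u)) = a ^+ 2 * Q (vsval u).
Proof. by rewrite linearZ quadZ. Qed.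

Fact res_polar_linearl Q W (w : subvs_of W) :
  scalar (polar (fun u : subvs_of W => Q (vsval u)) ^~ w).
Proof. by move=> a u v; exact: polar_linearl. Qed.

Fact res_polar_linearr Q W (u : subvs_of W) :
  scalar (polar (fun u : subvs_of W => Q (vsval u)) u).
Proof. by move=> a v w; exact: polar_linearr. Qed.

Definition res_quadform Q W : quadform (subvs_of W) :=
  QuadForm (@res_quadZ Q W) (@res_polar_linearl Q W) (@res_polar_linearr Q W).

(* Meaningful when W is phi-invariant; otherwise phi is followed by an
   unspecified projection onto W. *)
Definition res_lfun phi W : 'End(subvs_of W) :=
  (linfun (vsproj W) \o phi \o linfun (@vsval K V W))%VF.

Definition nondefective_subspace Q W : bool := nondefective (res_quadform Q W).

(* The orthogonal summand carried by W is res_lfun phi W acting on the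
   quadratic space (subvs_of W, res_quadform Q W). *)
Definition orthogonal_summand Q phi W : Prop :=
  [/\ W != 0%VS, nondefective_subspace Q W & invariant_subspace phi W].

Definition orthogonally_indecomposable Q phi : Prop :=
  {:V}%VS != 0%VS /\
  ~ exists W, orthogonal_summand Q phi W /\ W != {:V}%VS.

End Restriction.

(* Main.v *)
(* In characteristic 2 the image of [s - 1], for an involution [s] of O(V), is
   totally isotropic, so its dimension is at most half that of V.

   If phi = s t with involutions s, t, then s inverts phi, so everything is about
   the parity of dim (s - 1)V for the involutions s inverting phi. On the part of
   V where phi has no fixed vector this number is forced to be half the dimension.
   Split V orthogonally into indecomposable pieces W. If phi has no fixed vector
   on W, or if W is unipotent cyclic, then W is cyclic, and an inverting involution
   is phi^i u |-> phi^-i u. Otherwise W = K[phi]u + K[phi]v with two Jordan blocks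
   of the same size m, and for a suitable choice of v there is an inverting
   involution of the form u |-> u, v |-> v (m even), or u |-> u, v |-> phi v
   (m odd), or v |-> v + u |-> v (m odd). Counting fixed vectors gives the
   parities: both parities occur for the unipotent cyclic pieces and for m odd,
   and in all cases one can reach the parity of (dim W)/2. This gives the
   existence of factorizations.

   Conversely, when the unipotent part V1 of phi has only pieces with two blocks
   of even size, the subspace of V1 spanned by all N^i (ker N^2i), N = phi - 1, is
   a totally singular Lagrangian subspace which is invariant under every
   involution s inverting phi, and this forces dim (s - 1)V1 to be even. *)
Require Import Defs.
From HB Require Import structures.
From mathcomp Require Import all_boot all_algebra.
From mathcomp Require Import zify ring.
From Stdlib Require Import Classical_Prop.

Set Implicit Arguments.
Unset Strict Implicit.
Unset Printing Implicit Defensive.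

Import GRing.Theory.
Local Open Scope ring_scope.

(** Everything turns on [rho], the sum of [phi] and its inverse. It is self-adjoint, commutes with
    [phi] and with every involution inverting [phi], and equals [phi^-1 (phi - 1)^2], so on an
    indecomposable piece it is injective or nilpotent. Since [K[phi] = K[rho] + phi K[rho]],
    identities for all powers of [phi] become conditions on [K[rho]]. An inverting involution is
    prescribed on module generators; it exists once the Gram data of the families [phi^i u] and
    [phi^-i u'] agree. For one generator this is the symmetry of the polar form. For two, the cross
    terms [B (phi^k u) v] are the obstacle, and [v] is chosen orthogonal to a suitable
    [K[rho]]-module, or with prescribed pairings against it. Parities come from squeezing: an
    involution moves at most half of a nondegenerate space, less if it fixes a nondegenerate
    subspace, while the images of [s - 1] and [s phi - 1] must together account for that of
    [phi - 1]. *)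

Section Orthogonal.

Variables (K : fieldType) (V : vectType K) (Q : quadform V).
Hypothesis charK : 2%N \in [pchar K].
Implicit Types (x y z u v w : V) (T U W L : {vspace V}) (g h s : 'End(V)).

Local Notation B := (qpolar Q).

(** * Bilinear algebra of the polar form in characteristic 2 *)

Lemma qpolarDl u v w : B (u + v) w = B u w + B v w.
Proof. by have:= polar_linearl Q w 1 u v; rewrite scale1r mul1r. Qed.

Lemma qpolarDr u v w : B u (v + w) = B u v + B u w.
Proof. by have:= polar_linearr Q u 1 v w; rewrite scale1r mul1r. Qed.

Lemma qpolarC u v : B u v = B v u.
Proof. exact: polarC. Qed.

Lemma qpolar0l u : B 0 u = 0.
Proof. by apply: (addrI (B 0 u)); rewrite -qpolarDl !addr0. Qed.

Lemma qpolar0r u : B u 0 = 0.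
Proof. by rewrite qpolarC qpolar0l. Qed.

Lemma qpolarZl a u v : B (a *: u) v = a * B u v.
Proof.
by rewrite -[a *: u]addr0 /qpolar polar_linearl -/(B _ _) -/(B 0 v) qpolar0l addr0.
Qed.

Lemma qpolarZr a u v : B u (a *: v) = a * B u v.
Proof. by rewrite qpolarC qpolarZl qpolarC. Qed.

Lemma qpolar_suml I (r : seq I) (P : pred I) (F : I -> V) v :
  B (\sum_(i <- r | P i) F i) v = \sum_(i <- r | P i) B (F i) v.
Proof. by elim/big_rec2: _ => [|i a x _ <-]; rewrite ?qpolar0l ?qpolarDl. Qed.

Lemma qpolar_sumr I (r : seq I) (P : pred I) (F : I -> V) v :
  B v (\sum_(i <- r | P i) F i) = \sum_(i <- r | P i) B v (F i).
Proof. by rewrite qpolarC qpolar_suml; apply: eq_bigr => i _; rewrite qpolarC. Qed.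

Lemma quadD u v : Q (u + v) = Q u + Q v + B u v.
Proof.
by rewrite [RHS]addrC [Q u + Q v]addrC addrA /qpolar /polar !subrK.
Qed.

Lemma quad0 : Q 0 = 0.
Proof. by rewrite -(scale0r (0 : V)) quadZ expr0n mul0r. Qed.

Lemma addvv2 u : u + u = 0.
Proof. by rewrite -mulr2n -scaler_nat pcharf0 ?scale0r. Qed.

Lemma oppv2 u : - u = u.
Proof. by apply/eqP; rewrite eq_sym -addr_eq0 addvv2. Qed.

Lemma qpolarxx u : B u u = 0.
Proof. by rewrite /qpolar /polar addvv2 quad0 sub0r -opprD addrr_pchar2 ?oppr0. Qed.

Lemma eq_add2 u v : (u + v == 0) = (u == v).
Proof. by rewrite addr_eq0 oppv2. Qed.

Lemma addvK2 u v : u + (u + v) = v.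
Proof. by rewrite addrA addvv2 add0r. Qed.

Lemma eqk_add2 (a b : K) : (a + b == 0) = (a == b).
Proof. by rewrite addr_eq0 oppr_pchar2. Qed.

(** * Orthogonal complements *)

Definition perp W : {vspace V} := orthov (qpolar Q : {symmetric V}) W.

Lemma perpP W u : reflect (forall v, v \in W -> B u v = 0) (u \in perp W).
Proof. exact: mem_orthovP. Qed.

Lemma perpS U W : (U <= W)%VS -> (perp W <= perp U)%VS.
Proof.
move=> /subvP sUW; apply/subvP => x /perpP xW.
by apply/perpP => v /sUW; apply: xW.
Qed.

Lemma perp_sym U W : (U <= perp W)%VS = (W <= perp U)%VS.
Proof. exact: orthov_sym. Qed.

Lemma perpD U W : perp (U + W) = (perp U :&: perp W)%VS.
Proof.
apply/eqP; rewrite eqEsubv subv_cap !perpS ?addvSl ?addvSr //=.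
apply/subvP => x /memv_capP[/perpP xU /perpP xW].
by apply/perpP => _ /memv_addP[u Uu [w Ww ->]]; rewrite qpolarDr xU ?xW ?addr0.
Qed.

Lemma dim_cap_perp U W : (\dim U <= \dim (U :&: perp W) + \dim W)%N.
Proof.
pose h x : 'rV[K]_(\dim W) := \row_i B x (vbasis W)`_i.
have h_lin : linear h.
  by move=> a x y; apply/rowP => i; rewrite !mxE qpolarDl qpolarZl.
pose hL : {linear V -> 'rV[K]_(\dim W)} :=
  HB.pack h (GRing.isLinear.Build _ _ _ _ h h_lin).
have kerh : (U :&: perp W = U :&: lker (linfun hL))%VS.
  apply/vspaceP => x; rewrite !memv_cap; congr (_ && _).
  rewrite memv_ker lfunE; apply/perpP/eqP => [xW | hx0 v].
    by apply/rowP => i; rewrite !mxE xW // vbasis_mem // mem_nth ?size_tuple.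
  move/coord_vbasis->; rewrite qpolar_sumr big1 // => i _; rewrite qpolarZr.
  by have/rowP/(_ i) := hx0; rewrite !mxE => ->; rewrite mulr0.
rewrite kerh -{1}(limg_ker_dim (linfun hL) U) leq_add2l.
by have := dimvS (subvf (linfun hL @: U)%VS); rewrite dimvf dim_matrix mul1r.
Qed.

(** One half of row rank equals column rank for the pairing of [U] with [W]: after removing the two
    radicals, the complement [U'] pairs faithfully with [W'], so [\dim U' <= \dim W']. *)
Lemma dim_pairing_le U W :
  (\dim U + \dim (W :&: perp U) <= \dim W + \dim (U :&: perp W))%N.
Proof.
set W' := (W :\: (W :&: perp U))%VS; set U' := (U :\: (U :&: perp W))%VS.
have dW : (\dim (W :&: perp U) + \dim W' = \dim W)%N.
  by rewrite -(dimv_cap_compl W (W :&: perp U)) (capv_idPr (capvSl _ _)).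
have dU : (\dim (U :&: perp W) + \dim U' = \dim U)%N.
  by rewrite -(dimv_cap_compl U (U :&: perp W)) (capv_idPr (capvSl _ _)).
suff U'W' : (U' :&: perp W' = 0)%VS.
  by have := dim_cap_perp U' W'; rewrite U'W' dimv0; lia.
apply/eqP; rewrite -subv0 -(capv_diff U (U :&: perp W)) subv_cap capvSl /=.
apply/subvP => x /memv_capP[xU' /perpP xW'].
have xU : x \in U by apply: subvP (diffvSl _ _) _ xU'.
rewrite memv_cap xU; apply/perpP => w.
rewrite -{1}(addv_diff_cap W (W :&: perp U)) => /memv_addP[w1 Ww1 [w2 Ww2 ->]].
rewrite qpolarDr xW' // add0r qpolarC.
by move: Ww2 => /memv_capP[_ /memv_capP[_ /perpP]]; apply.
Qed.

Lemma dim_pairing U W :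
  (\dim U + \dim (W :&: perp U) = \dim W + \dim (U :&: perp W))%N.
Proof. by apply/eqP; rewrite eqn_leq !dim_pairing_le. Qed.

Definition nondeg W := (W :&: perp W == 0)%VS.

Lemma nondegP W : reflect (forall x, x \in W -> x \in perp W -> x = 0) (nondeg W).
Proof.
apply: (iffP eqP) => [W0 x xW xp | W0].
  by apply/eqP; rewrite -memv0 -W0 memv_cap xW.
by apply/eqP; rewrite -subv0; apply/subvP => x /memv_capP[xW /W0->]; rewrite ?mem0v.
Qed.

Lemma nondeg_sep W x : nondeg W -> x \in W -> x != 0 -> exists2 y, y \in W & B x y != 0.
Proof.
move=> /nondegP ndW xW x0; apply/mem_orthovPn; apply: contra x0 => xp.
exact/eqP/ndW.
Qed.

Lemma dim_perp_in U W : nondeg W -> (U <= W)%VS ->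
  (\dim U + \dim (W :&: perp U) = \dim W)%N.
Proof.
move=> /eqP ndW sUW; rewrite dim_pairing -[RHS]addn0; congr (_ + _)%N.
by apply/eqP; rewrite dimv_eq0 -subv0 -ndW capvS.
Qed.

Lemma perp_perp_in U W : nondeg W -> (U <= W)%VS -> (W :&: perp (W :&: perp U) = U)%VS.
Proof.
move=> ndW sUW; apply/eqP; rewrite eq_sym eqEdim subv_cap sUW perp_sym capvSr /=.
have := dim_perp_in ndW sUW; have := dim_perp_in ndW (capvSl W (perp U)); lia.
Qed.

Lemma nondeg_add U W : nondeg W -> (U <= W)%VS -> nondeg U -> (U + (W :&: perp U) = W)%VS.
Proof.
move=> ndW sUW /eqP ndU; apply/eqP; rewrite eqEdim subv_add sUW capvSl /=.
rewrite dimv_disjoint_sum ?(dim_perp_in ndW) //.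
by apply/eqP; rewrite -subv0 -ndU capvS ?capvSr.
Qed.

Lemma nondeg_compl U W : nondeg W -> (U <= W)%VS -> nondeg U -> nondeg (W :&: perp U).
Proof.
move=> ndW sUW /nondegP ndU; apply/nondegP => x /memv_capP[xW xU] xp.
by apply: ndU => //; rewrite -(perp_perp_in ndW sUW) memv_cap xW.
Qed.

Lemma nondeg_orth U W : nondeg U -> nondeg W -> (U <= perp W)%VS ->
  nondeg (U + W) /\ (\dim (U + W) = \dim U + \dim W)%N.
Proof.
move=> /nondegP ndU /nondegP ndW oUW.
have oWU : (W <= perp U)%VS by rewrite perp_sym.
split.
  apply/nondegP => _ /memv_addP[u uU [w wW ->]].
  rewrite perpD memv_cap => /andP[uwU uwW].
  have u0 : u = 0.
    by apply: ndU => //; rewrite -(addrK w u) memvB // (subvP oWU).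
  have w0 : w = 0.
    apply: ndW => //; have: u + w \in perp W by [].
    by rewrite u0 add0r.
  by rewrite u0 w0 addr0.
rewrite dimv_disjoint_sum //; apply/eqP; rewrite -subv0.
apply/subvP => x /memv_capP[xU xW]; rewrite memv0; apply/eqP/ndU => //.
exact: (subvP oWU).
Qed.

Lemma nondeg_plane x y : B x y != 0 ->
  nondeg (<[x]> + <[y]>) /\ \dim (<[x]> + <[y]>) = 2%N.
Proof.
move=> xy0.
have x0 : x != 0 by apply: contraNneq xy0 => ->; rewrite qpolar0l.
have y0 : y != 0 by apply: contraNneq xy0 => ->; rewrite qpolar0r.
split.
  apply/nondegP => _ /memv_addP[_ /vlineP[a ->] [_ /vlineP[b ->] ->]].
  move=> /perpP abp.
  have /eqP : B (a *: x + b *: y) y = 0.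
    by apply: abp; rewrite memvE addvSr.
  rewrite qpolarDl !qpolarZl qpolarxx mulr0 addr0 mulf_eq0 (negPf xy0) orbF => /eqP ->.
  have /eqP : B (a *: x + b *: y) x = 0.
    by apply: abp; rewrite memvE addvSl.
  rewrite qpolarDl !qpolarZl qpolarxx mulr0 add0r mulf_eq0 qpolarC (negPf xy0) orbF => /eqP ->.
  by rewrite !scale0r addr0.
rewrite dimv_disjoint_sum ?dim_vline ?x0 ?y0 //.
apply/eqP; rewrite -subv0; apply/subvP => _ /memv_capP[/vlineP[a ->]].
move=> /vlineP[b axb]; rewrite memv0 scaler_eq0 (negPf x0) orbF.
have /eqP : B (a *: x) y = 0 by rewrite axb qpolarZl qpolarxx mulr0.
by rewrite qpolarZl mulf_eq0 (negPf xy0) orbF.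
Qed.

(** The difference is the rank of the alternating form [B x (d y)] on [W], which is even because
    planes can be split off until the form vanishes. *)
Lemma even_alternating (d : 'End(V)) W : (forall x, x \in W -> B x (d x) = 0) ->
  ~~ odd (\dim W - \dim (W :&: d @^-1: perp W)).
Proof.
have [n] := ubnP (\dim W); elim: n W => // n IHn W ltWn alt.
have sym x y : x \in W -> y \in W -> B x (d y) = B y (d x).
  move=> xW yW; have := alt _ (memvD xW yW).
  rewrite linearD !qpolarDl !qpolarDr !alt // add0r addr0 => /eqP.
  by rewrite eqk_add2 => /eqP.
have [sW | ] := boolP (W <= d @^-1: perp W)%VS.
  by rewrite (capv_idPl sW) subnn.
case/subvPn => x xW; rewrite -memv_preim => /mem_orthovPn[y yW xy].
(* [W'] is the orthogonal of [U] for the form [B x (d y)], not for [B]; it has the same radical as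
   [W]. *)
set U := (<[x]> + <[y]>)%VS; set W' := (W :&: perp (d @: U))%VS.
have xy0 : B y (d x) != 0 by rewrite qpolarC.
have sU : (U <= W)%VS by rewrite subv_add -!memvE xW.
have W'P z : reflect [/\ z \in W, B z (d x) = 0 & B z (d y) = 0] (z \in W').
  rewrite memv_cap; apply: (iffP andP) => [[zW /perpP zp]|[zW zx zy]].
    by split=> //; apply: zp; rewrite memv_img // memvE ?addvSl ?addvSr.
  split=> //; apply/perpP => _ /memv_imgP[_ /memv_addP[_ /vlineP[a ->]
    [_ /vlineP[b ->] ->]] ->].
  by rewrite linearD !linearZ /= qpolarDr !qpolarZr zx zy !mulr0 addr0.
have W'U : (W' :&: U = 0)%VS.
  apply/eqP; rewrite -subv0; apply/subvP => z /memv_capP[/W'P[_ zx zy]].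
  case/memv_addP => _ /vlineP[a ->] [_ /vlineP[b ->] zE].
  move: zx zy; rewrite zE !qpolarDl !qpolarZl !alt // !mulr0 add0r addr0.
  rewrite (sym x y) // => /eqP; rewrite mulf_eq0 (negPf xy0) orbF => /eqP->.
  move/eqP; rewrite mulf_eq0 (negPf xy0) orbF => /eqP->.
  by rewrite !scale0r addr0 mem0v.
have W'_U : (W' + U = W)%VS.
  apply/eqP; rewrite eqEsubv subv_add capvSl sU /=; apply/subvP => z zW.
  pose a := B z (d y) / B y (d x); pose b := B z (d x) / B y (d x).
  have zE : z = (z - (a *: x + b *: y)) + (a *: x + b *: y) by rewrite subrK.
  rewrite zE memv_add //; last first.
    by rewrite memv_add // memvZ // memv_line.
  apply/W'P; rewrite !oppv2 !qpolarDl !qpolarZl !alt // !mulr0 add0r addr0.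
  rewrite (sym x y) // !divfK // !addrr_pchar2 //.
  by split=> //; rewrite !memvD ?memvZ.
have dU : \dim U = 2%N.
  have x0 : x != 0 by apply: contraNneq xy0 => ->; rewrite linear0 qpolar0r.
  have y0 : y != 0 by apply: contraNneq xy0 => ->; rewrite qpolar0l.
  rewrite dimv_disjoint_sum ?dim_vline ?x0 ?y0 //.
  apply/eqP; rewrite -subv0; apply/subvP => _ /memv_capP[/vlineP[a ->]].
  move=> /vlineP[b axb]; have /eqP : B (a *: x) (d y) = 0.
    by rewrite axb qpolarZl alt // mulr0.
  rewrite qpolarZl (sym x y) // mulf_eq0 (negPf xy0) orbF => /eqP->.
  by rewrite scale0r mem0v.
have dW : \dim W = (\dim W' + 2)%N by rewrite -dU -dimv_disjoint_sum ?W'_U.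
clearbody W'.
have -> : (W :&: d @^-1: perp W = W' :&: d @^-1: perp W')%VS.
  apply/vspaceP => z; rewrite !memv_cap -!memv_preim.
  apply/andP/andP => [[zW /perpP zp]|[zW' /perpP zp]]; last first.
    have [zW zx zy] := W'P _ zW'; split=> //; apply/perpP => w.
    rewrite -W'_U => /memv_addP[w' /zp zw'].
    case=> _ /memv_addP[_ /vlineP[a ->] [_ /vlineP[b ->] ->]] ->.
    by rewrite !qpolarDr !qpolarZr zw' !(qpolarC (d z)) sym // zx sym // zy !mulr0 !addr0.
  split; last by apply/perpP => w wW'; have [wW _ _] := W'P _ wW'; apply: zp.
  by apply/W'P; split=> //; rewrite sym // qpolarC zp.
have : ~~ odd (\dim W' - \dim (W' :&: d @^-1: perp W')).
  by apply: IHn => [|z /W'P[zW _ _]]; [lia | apply: alt].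
have := dimvS (capvSl W' (d @^-1: perp W')); lia.
Qed.

Lemma even_dim_nd W : nondeg W -> ~~ odd (\dim W).
Proof.
move=> /eqP ndW; have := @even_alternating \1 W.
have -> : (W :&: \1 @^-1: perp W = 0)%VS.
  by rewrite -ndW; apply/vspaceP => z; rewrite !memv_cap -memv_preim id_lfunE.
by rewrite dimv0 subn0; apply=> x _; rewrite id_lfunE qpolarxx.
Qed.

(** * Isometries and involutions *)

Hypothesis ndV : nondeg {:V}.

Lemma perp_perp W : perp (perp W) = W.
Proof. by have := perp_perp_in ndV (subvf W); rewrite !capfv. Qed.

Lemma nondeg_perp W : nondeg W -> nondeg (perp W).
Proof. by move/(nondeg_compl ndV (subvf W)); rewrite capfv. Qed.

Lemma addv_perp W : nondeg W -> (W + perp W)%VS = {:V}%VS.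
Proof. by move/(nondeg_add ndV (subvf W)); rewrite capfv. Qed.

Lemma dim_perp W : (\dim W + \dim (perp W))%N = \dim {:V}.
Proof. by have := dim_perp_in ndV (subvf W); rewrite capfv. Qed.

Definition isom (g : 'End(V)) := forall x, Q (g x) = Q x.

Lemma isomB g x y : isom g -> B (g x) (g y) = B x y.
Proof. by move=> gQ; rewrite /qpolar /polar -linearD !gQ. Qed.

Lemma isom_inj g x : isom g -> g x = 0 -> x = 0.
Proof.
move=> gQ gx0; have /nondegP := ndV; apply; rewrite ?memvf //.
by apply/perpP => y _; rewrite -(isomB _ _ gQ) gx0 qpolar0l.
Qed.

Lemma isom_lker0 g : isom g -> lker g == 0%VS.
Proof.
move=> gQ; rewrite -subv0; apply/subvP => x.
by rewrite memv_ker => /eqP/(isom_inj gQ)->; rewrite mem0v.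
Qed.

Definition stable (g : 'End(V)) W := (g @: W <= W)%VS.

Lemma stableP g W : reflect (forall x, x \in W -> g x \in W) (stable g W).
Proof.
apply: (iffP subvP) => [gW x xW | gW _ /memv_imgP[x xW ->]]; last exact: gW.
by rewrite gW ?memv_img.
Qed.

Lemma stable_perp g W : isom g -> stable g W -> stable g (perp W).
Proof.
move=> gQ gW; have gWE : (g @: W)%VS = W.
  have cap0 : (W :&: lker g = 0)%VS by rewrite (eqP (isom_lker0 gQ)) capv0.
  by apply/eqP; rewrite eqEdim [(_ <= _)%VS]gW (limg_dim_eq cap0) leqnn.
apply/stableP => x /perpP xW; apply/perpP => y; rewrite -gWE.
by case/memv_imgP => z zW ->; rewrite isomB // xW.
Qed.

Lemma stable_perpI g U W : isom g -> stable g U -> stable g W ->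
  stable g (W :&: perp U).
Proof.
move=> gQ gU gW; apply: subv_trans (limg_cap _ _ _) _.
exact: capvS gW (stable_perp gQ gU).
Qed.

Lemma stableD g U W : stable g U -> stable g W -> stable g (U + W).
Proof. by move=> gU gW; rewrite /stable limgD addvS. Qed.

(** The residual dimension of [g] along [W]; on the whole space its parity decides membership in the
    special orthogonal group. *)
Definition shift (g : 'End(V)) W := \dim ((g - \1)%VF @: W).

Lemma shiftE (g : 'End(V)) x : (g - \1)%VF x = g x + x.
Proof. by rewrite add_lfunE opp_lfunE id_lfunE oppv2. Qed.

Lemma eq_in_shift g h W : {in W, g =1 h} -> shift g W = shift h W.
Proof.
move=> gh; rewrite /shift; congr (\dim _); apply: eq_in_limg => x xW.
by rewrite !shiftE gh.
Qed.

Lemma shiftD g U W : stable g U -> stable g W -> (U :&: W = 0)%VS ->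
  shift g (U + W) = (shift g U + shift g W)%N.
Proof.
move=> /stableP gU /stableP gW UW; rewrite /shift limgD dimv_disjoint_sum //.
apply/eqP; rewrite -subv0 -UW; apply: capvS; apply/subvP => _ /memv_imgP[x xX ->].
  by rewrite shiftE memvD ?gU.
by rewrite shiftE memvD ?gW.
Qed.

(* The image of [W] under [t - 1] is isotropic, and orthogonal to the fixed space
   of [t]. *)
Lemma shift_involution (t : 'End(V)) W D : isom t -> stable t W ->
    (forall x, x \in W -> t (t x) = x) -> nondeg W ->
    (D <= W)%VS -> nondeg D -> (forall x, x \in D -> t x = x) ->
  ((shift t W).*2 + \dim D <= \dim W)%N.
Proof.
move=> tQ /stableP tW tK ndW sDW ndD fixD; rewrite /shift.
set I := ((t - \1)%VF @: W)%VS.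
have fixI x y : t x = x -> B x (t y + y) = 0.
  by move=> tx; rewrite qpolarDr -{1}tx isomB // addrr_pchar2.
have tI x : x \in W -> t (t x + x) = t x + x.
  by move=> xW; rewrite linearD /= tK // addrC.
have sIW : (I <= W)%VS.
  by apply/subvP => _ /memv_imgP[x xW ->]; rewrite shiftE memvD ?tW.
have ID : (I :&: D = 0)%VS.
  apply/eqP; rewrite -subv0 -(eqP ndD); apply/subvP => x /memv_capP[xI xD].
  rewrite memv_cap xD; apply/perpP => y yD; rewrite qpolarC.
  by case/memv_imgP: xI => z zW ->; rewrite shiftE fixI ?fixD.
have sID : (I <= W :&: perp (I + D))%VS.
  rewrite subv_cap sIW perp_sym; apply/subvP => _ /memv_addP[a aI [b bD ->]].
  apply/perpP => _ /memv_imgP[z zW ->]; rewrite shiftE fixI // linearD /= (fixD b) //.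
  by case/memv_imgP: aI => y yW ->; rewrite shiftE tI.
have := dim_perp_in ndW (_ : I + D <= W)%VS; rewrite subv_add sIW sDW.
move=> /(_ isT); rewrite dimv_disjoint_sum //; have := dimvS sID; lia.
Qed.

Lemma shift_involution_half (t : 'End(V)) W : isom t -> stable t W ->
    (forall x, x \in W -> t (t x) = x) -> nondeg W ->
  ((shift t W).*2 <= \dim W)%N.
Proof.
move=> tQ tW tK ndW.
have := @shift_involution t W 0%VS tQ tW tK ndW (sub0v _).
rewrite dimv0 addn0; apply; first by apply/eqP; rewrite cap0v.
by move=> x; rewrite memv0 => /eqP->; rewrite linear0.
Qed.

(** From [g - 1 = (s - 1) + s (s g - 1)], valid because [s] is an involution. *)
Lemma shift_comp (s g : 'End(V)) W : (forall x, s (s x) = x) ->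
  (shift g W <= shift s W + shift (s \o g)%VF W)%N.
Proof.
move=> sK; set I := ((s - \1)%VF @: W)%VS; set J := ((s \o g - \1)%VF @: W)%VS.
have sub : ((g - \1)%VF @: W <= I + s @: J)%VS.
  apply/subvP => _ /memv_imgP[x xW ->]; rewrite shiftE.
  have -> : g x + x = (s x + x) + s (s (g x) + x).
    by rewrite linearD /= sK [g x + s x]addrC addrACA addvv2 add0r addrC.
  rewrite memv_add //; first by rewrite -shiftE memv_img.
  by rewrite memv_img //; apply/memv_imgP; exists x; rewrite // shiftE comp_lfunE.
apply: leq_trans (dimvS sub) _; rewrite /shift -/I -/J.
apply: leq_trans (dimv_add_leqif _ _) _; rewrite leq_add2l.
by rewrite -(limg_ker_dim s J) leq_addl.
Qed.

(** * An isometry without nonzero fixed vectors *)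

Section FixedPointFreeIsometry.

Hypothesis dimV : (4 <= \dim {:V})%N.

(** If [Q] vanished off a proper subspace [U], then [Q u = B x u] for [u] in [U] and every [x]
    outside; so [Q] is additive on [U], which is isotropic and has at most half the dimension. In
    dimension at least 4 any [y] admits an [x] outside [U + <[y]>]; comparing [x] with [x + y] gives
    [B y u = 0], so [U] is zero and so is [Q]. *)
Lemma nonsingular_notin U : U != {:V}%VS -> exists2 u, u \notin U & Q u != 0.
Proof.
move=> UV; apply: NNPP => none.
have sing x : x \notin U -> Q x = 0.
  by move=> xU; apply/eqP/contraT => Qx; case: none; exists x.
have QU x u : x \notin U -> u \in U -> Q u = B x u.
  move=> xU uU; have := quadD x u; rewrite sing ?(sing x) // ?add0r.
    by move/esym/eqP; rewrite eqk_add2 // => /eqP.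
  by rewrite rpredDr.
have [x0 _ x0U] : exists2 x, x \in {:V}%VS & x \notin U.
  by apply/subvPn; apply: contra UV => sVU; rewrite eqEsubv subvf.
have isoU : (U <= perp U)%VS.
  apply/subvP => u uU; apply/perpP => v vU; have := quadD u v.
  rewrite !(QU x0) ?memvD // qpolarDr => /esym/eqP.
  by rewrite -subr_eq0 addrC addKr => /eqP.
have dU : ((\dim U).*2 <= \dim {:V})%N.
  by have := dimvS isoU; have := dim_perp U; move: (\dim _) (\dim _) (\dim _)
    => a b c; clear; lia.
have U0 : U = 0%VS.
  apply/eqP; rewrite -subv0 -(eqP ndV) capfv perp_sym; apply/subvP => y _.
  apply/perpP => u uU; have [x _ xUy] : exists2 x, x \in {:V}%VS & x \notin (U + <[y]>)%VS.
    apply/subvPn; apply/negP => /dimvS/leq_trans/(_ (dimv_add_leqif _ _)).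
    rewrite dim_vline; move: dimV dU; case: (y != 0);
      move: (\dim U) (\dim _) => a b; clear; lia.
  have xU : x \notin U by apply: contra xUy; apply/subvP/addvSl.
  have xyU : x + y \notin U.
    by apply: contra xUy => xyU; rewrite -(addrK y x) memvB ?(subvP (addvSl _ _) _ xyU) // memvE addvSr.
  apply/eqP; rewrite -(inj_eq (addrI (B x u))) addr0 -qpolarDl.
  by rewrite -!QU.
have [|y _ xy] := nondeg_sep ndV (memvf x0) _.
  by apply: contraNneq x0U => ->; rewrite mem0v.
case/negP: xy; rewrite /qpolar /polar; have Q0' x : Q x = 0.
  have [->|x_neq0] := eqVneq x 0; first exact: quad0.
  by rewrite sing // U0 memv0.
by rewrite !Q0' !subr0.
Qed.

Let transvection u : 'End(V) := linfun (fun x => x + (B x u / Q u) *: u).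

Lemma transvectionE u x : transvection u x = x + (B x u / Q u) *: u.
Proof.
pose h x := x + (B x u / Q u) *: u.
have h_lin : linear h.
  move=> a y z; rewrite /h qpolarDl qpolarZl mulrDl scalerDl scalerDr addrACA -!mulrA.
  by rewrite scalerA.
pose hL : {linear V -> V} := HB.pack h (GRing.isLinear.Build _ _ _ _ h h_lin).
exact: (lfunE hL).
Qed.

Lemma transvection_isom u : Q u != 0 -> isom (transvection u).
Proof.
move=> Qu x; rewrite transvectionE quadD quadZ qpolarZr -addrA -[RHS]addr0; congr (_ + _).
by rewrite expr2 -mulrA divfK // addrr_pchar2.
Qed.

(** With [F] the fixed space, composing with the transvection along a nonsingular [u] outside
    [perp F] shrinks the fixed space into [F :&: perp <[u]>]. The resulting isometry is the
    obstruction to bireflectionality when the dimension is 2 modulo 4. *)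
Lemma fixed_point_free_isometry : exists2 g, isom g & lker (g - \1)%VF = 0%VS.
Proof.
suff key n g : isom g -> (\dim (fixedSpace g) < n)%N ->
    exists2 g, isom g & lker (g - \1)%VF = 0%VS.
  by apply: (key (\dim (fixedSpace \1%VF)).+1 \1%VF) => // x; rewrite id_lfunE.
elim: n g => // n IHn g gQ lt_n; set F := fixedSpace g in lt_n.
have [F0|F0] := eqVneq F 0%VS; first by exists g.
have FP x : (x \in F) = (g x == x) by rewrite memv_ker shiftE // eq_add2.
have pF : perp F != {:V}%VS.
  apply: contra F0 => /eqP pF; rewrite -dimv_eq0.
  have := dim_perp F; rewrite pF; move: (\dim F) (\dim _) => a b; clear; lia.
have [u uF Qu] := nonsingular_notin pF.
have tg : isom (transvection u \o g)%VF.
  by move=> x; rewrite comp_lfunE transvection_isom.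
have le_n : (\dim F <= n)%N by [].
apply: IHn tg _; apply: leq_trans le_n.
have ltF : (\dim (F :&: perp <[u]>) < \dim F)%N.
  rewrite (ltn_leqif (dimv_leqif_sup (capvSl _ _))) subv_cap subvv /=.
  by rewrite perp_sym -memvE.
apply: leq_ltn_trans (dimvS _) ltF; apply/subvP => x.
rewrite memv_ker shiftE // eq_add2 // comp_lfunE transvectionE => /eqP gx.
(* This multiple of [u] lies in the image of [g - 1], which is orthogonal to the fixed space of [g];
   as [u] is not, the coefficient vanishes. *)
have cu : (B (g x) u / Q u) *: u = g x + x by rewrite -{3}gx addvK2.
have c0 : B (g x) u / Q u = 0.
  apply/eqP; apply: contraNT uF => c0; rewrite -[u](scalerK c0) cu memvZ //.
  apply/perpP => y; rewrite FP => /eqP gy.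
  have gxy : B (g x) y = B x y by rewrite -{1}gy isomB.
  by rewrite qpolarDl gxy addrr_pchar2.
move: gx; rewrite c0 scale0r addr0 => gx; rewrite memv_cap FP gx eqxx /=.
apply/perpP => _ /vlineP[c ->]; rewrite qpolarZr; move: c0; rewrite gx => /eqP.
by rewrite mulf_eq0 invr_eq0 (negPf Qu) orbF => /eqP->; rewrite mulr0.
Qed.

End FixedPointFreeIsometry.

Variable phi : 'End(V).
Hypothesis phiQ : isom phi.

(** * Involutions inverting an isometry *)

(** Being the identity on [perp W] forces [s] to preserve [W] and lets the involutions of orthogonal
    pieces be multiplied. The last clause says that [s \o phi] is an involution on [W], that is, [s]
    inverts [phi] there. *)
Definition inverts W (s : 'End(V)) :=
  [/\ isom s, forall x, s (s x) = x, forall x, x \in perp W -> s x = x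
    & forall x, x \in W -> s (phi (s (phi x))) = x].

(* The restriction of [phi] to [W] is the product of the involutions [s] and
   [s \o phi]; the last condition makes the parities of the dimensions of the
   images of [s - 1], [s phi - 1] and [phi - 1] add up, so that the Dickson
   homomorphism is not needed. *)
Definition split_parity W e := exists s, [/\ inverts W s, odd (shift s W) = e
  & ~~ odd (shift s W + shift (s \o phi)%VF W + shift phi W)].

Lemma inverts_stable W s : inverts W s -> stable s W.
Proof.
case=> sQ _ fixs _; rewrite -(perp_perp W); apply: stable_perp => //.
by apply/stableP => x xW; rewrite fixs.
Qed.

(** Each involution is the identity where the other acts, so their product is again an involution,
    and every [shift] involved is the sum of its values on [U] and [W]. *)
Lemma split_parityD U W e e' : nondeg U -> nondeg W -> (U <= perp W)%VS ->
    stable phi U -> stable phi W ->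
  split_parity U e -> split_parity W e' -> split_parity (U + W) (e (+) e').
Proof.
move=> ndU ndW oUW phiU phiW [s [sU s_odd s_ev]] [t [tW t_odd t_ev]].
have oWU : (W <= perp U)%VS by rewrite perp_sym.
have UW0 : (U :&: W = 0)%VS.
  by apply/eqP; rewrite -subv0 -(eqP ndU) capvS.
have stU := stableP _ _ (inverts_stable sU); have ttW := stableP _ _ (inverts_stable tW).
have phU := stableP _ _ phiU; have phW := stableP _ _ phiW.
case: sU tW => sQ sK sfix sinv [tQ tK tfix tinv].
have tU x : x \in U -> t x = x by move=> xU; rewrite tfix ?(subvP oUW).
have sW x : x \in W -> s x = x by move=> xW; rewrite sfix ?(subvP oWU).
have tpU : stable t (perp U).
  by apply: stable_perp => //; apply/stableP => x xU; rewrite tU.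
have comm x : s (t x) = t (s x).
  have : x \in (U + perp U)%VS by rewrite addv_perp ?memvf.
  case/memv_addP => u uU [p pU ->]; rewrite !linearD /= tU // (sfix p) //.
  by rewrite (sfix (t p)) ?(stableP _ _ tpU) // (tU (s u)) ?stU.
have rU x : x \in U -> (s \o t)%VF x = s x by move=> xU; rewrite comp_lfunE tU.
have rW x : x \in W -> (s \o t)%VF x = t x.
  by move=> xW; rewrite comp_lfunE sW ?ttW.
have shD g h1 h2 : {in U, g =1 h1} -> {in W, g =1 h2} ->
    (forall x, x \in U -> h1 x \in U) -> (forall x, x \in W -> h2 x \in W) ->
  shift g (U + W) = (shift h1 U + shift h2 W)%N.
  move=> gh1 gh2 h1U h2W; rewrite shiftD ?(eq_in_shift gh1) ?(eq_in_shift gh2) //.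
    by apply/stableP => x xU; rewrite gh1 ?h1U.
  by apply/stableP => x xW; rewrite gh2 ?h2W.
have e1 : shift (s \o t)%VF (U + W) = (shift s U + shift t W)%N by exact: shD.
have e2 : shift ((s \o t) \o phi)%VF (U + W)
    = (shift (s \o phi)%VF U + shift (t \o phi)%VF W)%N.
  apply: shD => x xX; rewrite comp_lfunE.
  + by rewrite rU ?phU // comp_lfunE.
  + by rewrite rW ?phW // comp_lfunE.
  + by rewrite stU ?phU.
  + by rewrite ttW ?phW.
have e3 : shift phi (U + W) = (shift phi U + shift phi W)%N by exact: shD.
exists (s \o t)%VF; split.
- split=> [x|x|x|x].
  + by rewrite comp_lfunE sQ tQ.
  + by rewrite !comp_lfunE comm sK tK.
  + by rewrite perpD => /memv_capP[xU xW]; rewrite comp_lfunE tfix ?sfix.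
  case/memv_addP => u uU [w wW ->]; rewrite !linearD /=.
  have pu := phU _ uU; have pw := phW _ wW; have spu := phU _ (stU _ pu).
  have tpw := phW _ (ttW _ pw).
  by rewrite (rU _ pu) (rW _ pw) (rU _ spu) (rW _ tpw) sinv ?tinv.
- by rewrite e1 oddD s_odd t_odd.
- move: s_ev t_ev; rewrite e1 e2 e3 !oddD.
  by do 6 case: (odd (shift _ _)).
Qed.

(** * Isometries prescribed by Gram data *)

Section WittExtension.

Variables (I : finType) (e e' : I -> V) (W : {vspace V}).
Hypotheses (ndW : nondeg W) (spanW : (W <= <<codom e>>)%VS).
Hypotheses (eW : forall i, e i \in W) (e'W : forall i, e' i \in W).
Hypothesis spanW' : (W <= <<codom e'>>)%VS.
Hypothesis Bee' : forall i j, B (e i) (e j) = B (e' i) (e' j).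
Hypothesis Qee' : forall i, Q (e i) = Q (e' i).

Let comb (a : I -> V) (c : {ffun I -> K^o}) := \sum_i c i *: a i.

Let comb_linear a : linear (comb a).
Proof.
move=> k c d; rewrite /comb scaler_sumr -big_split; apply: eq_bigr => i _.
by rewrite !ffunE scalerDl scalerA.
Qed.

HB.instance Definition _ a := GRing.isLinear.Build _ _ _ _ (comb a) (comb_linear a).

Let comb_sum a c i : comb a [ffun j => (j == i)%:R * c] = c *: a i.
Proof.
rewrite /comb (bigD1 i) //= ffunE eqxx mul1r big1 ?addr0 // => j ji.
by rewrite ffunE (negPf ji) mul0r scale0r.
Qed.

Let combW a c : (forall i, a i \in W) -> comb a c \in W.
Proof. by move=> aW; apply: memv_suml => i _; rewrite memvZ. Qed.

(** Well-definedness of [e i |-> e' i] for families that need not be free: with equal Gram matrices,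
    the image of a relation is orthogonal to all [e' j], hence to [W]. *)
Let comb_eq0 c : comb e c = 0 -> comb e' c = 0.
Proof.
move=> ec0; apply: (nondegP _ ndW); first exact: combW.
rewrite memvE perp_sym (subv_trans spanW') //; apply/span_subvP => _ /codomP[j ->].
apply/perpP => _ /vlineP[k ->]; rewrite qpolarZr.
have -> : B (e' j) (comb e' c) = B (e j) (comb e c).
  by rewrite /comb !qpolar_sumr; apply: eq_bigr => i _; rewrite !qpolarZr Bee'.
by rewrite ec0 qpolar0r mulr0.
Qed.

Let comb_Q c : Q (comb e c) = Q (comb e' c).
Proof.
rewrite /comb; elim: (index_enum I) => [|i r IHr]; first by rewrite !big_nil.
rewrite !big_cons !quadD !quadZ Qee' IHr !qpolarZl !qpolar_sumr; congr (_ + _ * _).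
by apply: eq_bigr => j _; rewrite !qpolarZr Bee'.
Qed.

Lemma witt_extension : exists s : 'End(V),
  [/\ isom s, forall x, x \in perp W -> s x = x & forall i, s (e i) = e' i].
Proof.
pose E := linfun (comb e); pose E' := linfun (comb e').
pose pi := daddv_pi W (perp W).
have WpW : (W :&: perp W = 0)%VS by exact/eqP.
have imE x : x \in W -> E (E^-1%VF x) = x.
  move=> xW; apply: limg_lfunVK; apply: subvP xW; apply: subv_trans spanW _.
  apply/span_subvP => _ /codomP[i ->]; apply/memv_imgP.
  by exists [ffun j => (j == i)%:R * 1]; rewrite ?memvf // lfunE /= comb_sum scale1r.
have piW x : x \in W -> pi x = x by move=> xW; rewrite daddv_pi_id.
have pi0 x : x \in perp W -> pi x = 0.
  move=> xW; have := daddv_pi_add WpW (_ : x \in W + perp W)%VS.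
  rewrite addv_perp // memvf => /(_ isT); rewrite (daddv_pi_id _ xW) 1?capvC //.
  by move/(canRL (addrK _)); rewrite subrr.
(* On [W], [E^-1] picks some coefficients of a vector with respect to the [e i]; on [perp W] the map
   is the identity. *)
exists (E' \o E^-1 \o pi + (\1 - pi))%VF.
have sW x : x \in W -> (E' \o E^-1 \o pi + (\1 - pi))%VF x = E' (E^-1%VF x).
  move=> xW; rewrite !(add_lfunE, comp_lfunE, opp_lfunE) id_lfunE piW //.
  by rewrite subrr addr0.
have sp x : x \in perp W -> (E' \o E^-1 \o pi + (\1 - pi))%VF x = x.
  move=> xW; rewrite !(add_lfunE, comp_lfunE, opp_lfunE) id_lfunE pi0 //.
  by rewrite !linear0 add0r addr0.
split=> [x|//|i].
  have : x \in (W + perp W)%VS by rewrite addv_perp ?memvf.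
  case/memv_addP => w wW [p pW ->]; rewrite linearD /= sW // sp // !quadD.
  rewrite ![B _ p]qpolarC !(perpP _ _ pW) // ?lfunE ?combW //= -comb_Q.
  by rewrite -[comb e _](lfunE (comb e)) imE.
rewrite sW //; apply/eqP; rewrite -eq_add2 -[e' i]scale1r -comb_sum.
rewrite lfunE /= -linearD /= comb_eq0 //.
by rewrite linearD /= comb_sum scale1r -[comb e _](lfunE (comb e)) imE ?addvv2.
Qed.

End WittExtension.

(** * Powers, polynomials and cyclic subspaces *)

Fixpoint pow g k : 'End(V) := if k is k'.+1 then (g \o pow g k')%VF else \1%VF.

Arguments pow : simpl never.

Lemma pow0 g x : pow g 0 x = x.
Proof. by rewrite id_lfunE. Qed.

Lemma powS g k x : pow g k.+1 x = g (pow g k x).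
Proof. by rewrite comp_lfunE. Qed.

Lemma pow_comm g h k x : (forall z, g (h z) = h (g z)) ->
  pow g k (h x) = h (pow g k x).
Proof. by move=> gh; elim: k => [|k IHk]; rewrite ?pow0 // !powS IHk gh. Qed.

Lemma powSr g k x : pow g k.+1 x = pow g k (g x).
Proof. by rewrite powS pow_comm. Qed.

Lemma powD g i j x : pow g (i + j) x = pow g i (pow g j x).
Proof. by elim: i => [|i IHi]; rewrite ?pow0 // addSn !powS IHi. Qed.

Lemma pow_stable g W k : stable g W -> stable (pow g k) W.
Proof.
move=> /stableP gW; apply/stableP => x xW.
by elim: k => [|k IHk]; rewrite ?pow0 ?powS ?gW.
Qed.

Lemma pow_eq0 g i j x : (i <= j)%N -> pow g i x = 0 -> pow g j x = 0.
Proof. by move=> /subnK<- gx0; rewrite powD gx0 linear0. Qed.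

Lemma pow_adj g h k : (forall x z, B (g x) z = B x (h z)) ->
  forall x z, B (pow g k x) z = B x (pow h k z).
Proof.
move=> gh; elim: k => [|k IHk] x z; rewrite ?pow0 //.
by rewrite powS gh IHk powSr.
Qed.

Implicit Types (p q : {poly K}) (c : K).

Definition pol g (p : {poly K}) : 'End(V) := \sum_(i < size p) p`_i *: pow g i.

Lemma pol_widen n g p : (size p <= n)%N -> pol g p = \sum_(i < n) p`_i *: pow g i.
Proof.
move=> le_pn; rewrite /pol (big_ord_widen n (fun i => p`_i *: pow g i)) //.
rewrite big_mkcond; apply: eq_bigr => i _; case: ltnP => // le_pi.
by rewrite nth_default ?scale0r.
Qed.

Lemma pol_add g p q x : pol g (p + q) x = pol g p x + pol g q x.
Proof.
rewrite (@pol_widen (maxn (size p) (size q)) g (p + q)) ?size_polyD //.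
rewrite (@pol_widen (maxn (size p) (size q)) g p) ?leq_maxl //.
rewrite (@pol_widen (maxn (size p) (size q)) g q) ?leq_maxr //.
rewrite -add_lfunE -big_split /=.
by congr (fun_of_lfun _ _); apply: eq_bigr => i _; rewrite coefD scalerDl.
Qed.

Lemma pol_polyC g c x : pol g c%:P x = c *: x.
Proof.
rewrite (pol_widen g (size_polyC_leq1 c)) big_ord1 coefC eqxx scale_lfunE.
by rewrite pow0.
Qed.

Lemma pol_0 g x : pol g 0 x = 0.
Proof. by rewrite pol_polyC scale0r. Qed.

Lemma pol_mulX g p x : pol g (p * 'X) x = pol g p (g x).
Proof.
have le1 : (size (p * 'X)%R <= (size p).+1)%N.
  by rewrite (leq_trans (size_polyMleq _ _)) // size_polyX addn2.
rewrite (pol_widen g le1) big_ord_recl coefMX eqxx scale0r add0r /pol !sum_lfunE.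
by apply: eq_bigr => i _; rewrite !scale_lfunE lift0 coefMX /= powSr.
Qed.

Lemma pol_comm g h p x : (forall z, g (h z) = h (g z)) ->
  pol g p (h x) = h (pol g p x).
Proof.
move=> gh; rewrite !sum_lfunE linear_sum /=; apply: eq_bigr => i _.
by rewrite !scale_lfunE linearZ /= pow_comm.
Qed.

Lemma pol_scale g c p x : pol g (c *: p) x = c *: pol g p x.
Proof.
rewrite (pol_widen g (size_scale_leq c p)) /pol !sum_lfunE scaler_sumr.
by apply: eq_bigr => i _; rewrite !scale_lfunE coefZ scalerA.
Qed.

Lemma pol_mul g p q x : pol g (p * q) x = pol g p (pol g q x).
Proof.
elim/poly_ind: p x => [|p c IHp] x; first by rewrite mul0r !pol_0.
rewrite mulrDl pol_add -mulrA ['X * q]mulrC mulrA pol_mulX IHp !pol_add pol_mulX pol_polyC.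
by rewrite mul_polyC pol_scale (pol_comm q x (fun z => erefl (g (g z)))).
Qed.

Lemma pol_X g x : pol g 'X x = g x.
Proof. by rewrite -['X]mul1r pol_mulX pol_polyC scale1r. Qed.

Lemma pol_Xn g k x : pol g 'X^k x = pow g k x.
Proof.
elim: k => [|k IHk]; first by rewrite pol_polyC scale1r pow0.
by rewrite exprS pol_mul pol_X IHk powS.
Qed.

Lemma pol_exp g p k x : pol g (p ^+ k) x = pow (pol g p) k x.
Proof.
elim: k => [|k IHk]; first by rewrite pol_polyC scale1r pow0.
by rewrite exprS pol_mul IHk powS.
Qed.

Lemma pol_stable g W p : stable g W -> stable (pol g p) W.
Proof.
move=> gW; apply/stableP => x xW; rewrite sum_lfunE; apply: memv_suml => i _.
by rewrite scale_lfunE memvZ // (stableP _ _ (pow_stable _ gW)).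
Qed.

Lemma pol_adj g h p : (forall x z, B (g x) z = B x (h z)) ->
  forall x z, B (pol g p x) z = B x (pol h p z).
Proof.
move=> gh x z; rewrite !sum_lfunE qpolar_suml qpolar_sumr; apply: eq_bigr => i _.
by rewrite !scale_lfunE qpolarZl qpolarZr (pow_adj _ gh).
Qed.

Definition cyc g u : {vspace V} :=
  <<[seq pow g i u | i <- iota 0 (\dim {:V})]>>%VS.

Lemma cyc_min g u W : stable g W -> u \in W -> (cyc g u <= W)%VS.
Proof.
move=> gW uW; apply/span_subvP => _ /mapP[i _ ->].
by rewrite (stableP _ _ (pow_stable _ gW)).
Qed.

(** By dimension, some iterate [pow g k u] with [k <= \dim {:V}] depends on the earlier ones; their
    span is then already stable, so [\dim {:V}] iterates suffice in [cyc]. *)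
Lemma cyc_stable g u : stable g (cyc g u) /\ u \in cyc g u.
Proof.
pose S k := <<[seq pow g i u | i <- iota 0 k]>>%VS.
have inS i k : (i < k)%N -> pow g i u \in S k.
  by move=> ik; apply/memv_span/map_f; rewrite mem_iota.
have SS k : S k.+1 = (S k + <[pow g k u]>)%VS.
  by rewrite /S -addn1 iotaD map_cat span_cat span_seq1.
have [k le_kn gk] : exists2 k, (k <= \dim {:V})%N & pow g k u \in S k.
  have [/existsP[[k ltk] /= gk]|] :=
    boolP [exists k : 'I_(\dim {:V}).+1, pow g k u \in S k].
    by exists k.
  rewrite negb_exists => /forallP noS.
  suff dS k : (k <= (\dim {:V}).+1)%N -> \dim (S k) = k.
    by have := dimvS (subvf (S (\dim {:V}).+1)); rewrite dS // ltnn.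
  elim: k => [|k IHk] lek; first by rewrite /S span_nil dimv0.
  have gk := noS (Ordinal lek).
  have gk0 : pow g k u != 0 by apply: contraNneq gk => /= ->; rewrite mem0v.
  rewrite SS dimv_disjoint_sum ?IHk 1?ltnW //.
    have -> : \dim <[pow g k u]> = 1%N by rewrite dim_vline gk0.
    by rewrite addn1.
  apply/eqP; rewrite -subv0; apply/subvP => z /memv_capP[zS /vlineP[c zE]].
  have [c0|c0] := eqVneq c 0; first by rewrite zE c0 scale0r mem0v.
  case/negP: gk; rewrite /= -[pow g k u](scalerK c0) -zE; exact: memvZ.
have stS : stable g (S k).
  rewrite /stable limg_span; apply/span_subvP => _ /mapP[_ /mapP[i + ->] ->].
  rewrite mem_iota add0n => /= ik; rewrite -powS.
  by move: ik; rewrite leq_eqVlt => /predU1P[->|/inS].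
have uS : u \in S k.
  case: k {le_kn} gk stS => [|k] gk stS; last by rewrite -(pow0 g u) inS.
  by move: gk; rewrite pow0.
suff -> : cyc g u = S k by [].
apply/eqP; rewrite eqEsubv (cyc_min stS uS) /=; apply: sub_span => _ /mapP[i + ->].
by rewrite mem_iota => /= ik; apply: map_f; rewrite mem_iota /= (leq_trans ik).
Qed.

Lemma cyc_gen g u : u \in cyc g u.
Proof. by have [] := cyc_stable g u. Qed.

Lemma stable_cyc g u : stable g (cyc g u).
Proof. by have [] := cyc_stable g u. Qed.

Lemma cyc_pow g k u : pow g k u \in cyc g u.
Proof. exact: (stableP _ _ (pow_stable k (stable_cyc g u))) (cyc_gen g u). Qed.

Lemma cyc_pol g p u : pol g p u \in cyc g u.
Proof. exact: (stableP _ _ (pol_stable p (stable_cyc g u))) (cyc_gen g u). Qed.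

Lemma cycP g u x : reflect (exists p, x = pol g p u) (x \in cyc g u).
Proof.
apply: (iffP idP) => [|[p ->]]; last exact: cyc_pol.
rewrite /cyc; elim: (iota _ _) x => [|i r IHr] x /=.
  by rewrite span_nil memv0 => /eqP->; exists 0; rewrite pol_0.
rewrite span_cons => /memv_addP[_ /vlineP[c ->] [_ /IHr[p ->] ->]].
by exists (c *: 'X^i + p); rewrite pol_add pol_scale pol_Xn.
Qed.

Local Notation psi := (phi^-1)%VF.
Local Notation N := (phi - \1)%VF.
Local Notation N' := (psi - \1)%VF.
Local Notation rho := (phi + psi)%VF.

(** * Constructing inverting involutions *)

Lemma phiK x : psi (phi x) = x.
Proof. exact: lker0_lfunK (isom_lker0 phiQ) x. Qed.

Lemma psiK x : phi (psi x) = x.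
Proof. exact: lker0_lfunVK (isom_lker0 phiQ) x. Qed.

Lemma psiQ : isom psi.
Proof. by move=> x; rewrite -phiQ psiK. Qed.

Lemma phi_adj x z : B (phi x) z = B x (psi z).
Proof. by rewrite -(isomB x _ phiQ) psiK. Qed.

Lemma psi_adj x z : B (psi x) z = B x (phi z).
Proof. by rewrite qpolarC -phi_adj qpolarC. Qed.

Lemma N_adj x z : B (N x) z = B x (N' z).
Proof. by rewrite !shiftE qpolarDl qpolarDr phi_adj. Qed.

Lemma N'_adj x z : B (N' x) z = B x (N z).
Proof. by rewrite !shiftE qpolarDl qpolarDr psi_adj. Qed.

Lemma rhoE x : rho x = phi x + psi x.
Proof. by rewrite add_lfunE. Qed.

Lemma rho_adj x z : B (rho x) z = B x (rho z).
Proof. by rewrite !rhoE qpolarDl qpolarDr phi_adj psi_adj addrC. Qed.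


Lemma N'N x : N' (N x) = rho x.
Proof.
rewrite !shiftE linearD /= phiK rhoE [x + psi x]addrC addrACA.
by rewrite addvv2 addr0 addrC.
Qed.

Lemma stable_psi W : stable phi W -> stable psi W.
Proof.
move=> phiW; have phiWE : (phi @: W)%VS = W.
  have cap0 : (W :&: lker phi = 0)%VS.
    by rewrite (eqP (isom_lker0 phiQ)) capv0.
  by apply/eqP; rewrite eqEdim [(_ <= _)%VS]phiW (limg_dim_eq cap0) leqnn.
by apply/stableP => x; rewrite -{1}phiWE => /memv_imgP[z zW ->]; rewrite phiK.
Qed.

Lemma stable_phi W : stable psi W -> stable phi W.
Proof.
move=> psiW; have psiWE : (psi @: W)%VS = W.
  have cap0 : (W :&: lker psi = 0)%VS.
    by rewrite (eqP (isom_lker0 psiQ)) capv0.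
  by apply/eqP; rewrite eqEdim [(_ <= _)%VS]psiW (limg_dim_eq cap0) leqnn.
by apply/stableP => x; rewrite -{1}psiWE => /memv_imgP[z zW ->]; rewrite psiK.
Qed.

Lemma stable_N W : stable phi W -> stable N W.
Proof. by move/stableP => pW; apply/stableP => x xW; rewrite shiftE memvD ?pW. Qed.

Lemma stable_rho W : stable phi W -> stable rho W.
Proof.
move=> pW; apply/stableP => x xW.
by rewrite rhoE memvD ?(stableP _ _ pW) ?(stableP _ _ (stable_psi pW)).
Qed.

Lemma pow_isom g k : isom g -> isom (pow g k).
Proof. by move=> gQ; elim: k => [|k IHk] x; rewrite ?pow0 // powS gQ. Qed.

Definition generates (J : finType) (g : J -> V) W :=
  (forall a, g a \in W) /\
  forall U, stable phi U -> (forall a, g a \in U) -> (W <= U)%VS.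

Section Inverter.

Variables (J : finType) (g g' : J -> V) (W : {vspace V}).
Hypotheses (ndW : nondeg W) (phiW : stable phi W).
Hypotheses (genW : generates g W) (genW' : generates g' W).
Hypothesis Qgg' : forall a, Q (g a) = Q (g' a).
Hypothesis Bgg' : forall a b k,
  B (pow phi k (g a)) (g b) = B (g' a) (pow phi k (g' b)).

Let gen_cyc : (W <= \sum_a cyc phi (g a))%VS.
Proof.
have [_ ] := genW; apply=> [|a].
  apply/stableP => x /memv_sumP[z zc ->]; rewrite linear_sum /=.
  by apply: memv_suml => a _; apply: subvP (sumv_sup a _ (subvv _)) _ _;
     rewrite ?(stableP _ _ (stable_cyc _ _)) ?zc.
by apply: subvP (sumv_sup a _ (subvv _)) _ _; rewrite ?cyc_gen.
Qed.

Let gen_cyc' : (W <= \sum_a cyc psi (g' a))%VS.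
Proof.
have [_ ] := genW'; apply=> [|a].
  apply: stable_phi; apply/stableP => x /memv_sumP[z zc ->]; rewrite linear_sum /=.
  by apply: memv_suml => a _; apply: subvP (sumv_sup a _ (subvv _)) _ _;
     rewrite ?(stableP _ _ (stable_cyc _ _)) ?zc.
by apply: subvP (sumv_sup a _ (subvv _)) _ _; rewrite ?cyc_gen.
Qed.

(** Only the difference of the exponents matters, the common power being an isometry; so [Bgg']
    yields all Gram entries. *)
Let gram a b i j : B (pow phi i (g a)) (pow phi j (g b)) =
  B (pow psi i (g' a)) (pow psi j (g' b)).
Proof.
have [/subnKC<-|/ltnW/subnKC<-] := leqP j i; rewrite !powD.
  rewrite (isomB _ _ (pow_isom j phiQ)) (isomB _ _ (pow_isom j psiQ)) Bgg'.
  by rewrite (pow_adj _ psi_adj).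
rewrite (isomB _ _ (pow_isom i phiQ)) (isomB _ _ (pow_isom i psiQ)).
by rewrite qpolarC Bgg' [RHS]qpolarC (pow_adj _ psi_adj).
Qed.

Lemma inverter_exists : exists s : 'End(V),
  [/\ isom s, forall x, x \in perp W -> s x = x,
      forall x, x \in W -> s (phi x) = psi (s x) & forall a, s (g a) = g' a].
Proof.
pose n := \dim {:V}.
(* Exponents run up to [n] although those below [n] already span: the extra one keeps [phi] of each
   spanning vector in the family, where [s] is known. *)
pose e (ai : J * 'I_n.+1) := pow phi ai.2 (g ai.1).
pose e' (ai : J * 'I_n.+1) := pow psi ai.2 (g' ai.1).
have eE a i : (i <= n)%N -> pow phi i (g a) = e (a, inord i).
  by move=> le_in; rewrite /e /= inordK.
have e'E a i : (i <= n)%N -> pow psi i (g' a) = e' (a, inord i).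
  by move=> le_in; rewrite /e' /= inordK.
have [|ai|ai||||s [sQ sp se]] := @witt_extension _ e e' W ndW.
- apply: subv_trans gen_cyc _; apply/subv_sumP => a _; apply/span_subvP => z.
  case/mapP => i + ->; rewrite mem_iota => /andP[_ /ltnW le_in].
  by rewrite eE // memv_span ?codom_f.
- by rewrite (stableP _ _ (pow_stable _ phiW)) //; have [] := genW.
- rewrite (stableP _ _ (pow_stable _ (stable_psi phiW))) //.
  by have [] := genW'.
- apply: subv_trans gen_cyc' _; apply/subv_sumP => a _; apply/span_subvP => z.
  case/mapP => i + ->; rewrite mem_iota => /andP[_ /ltnW le_in].
  by rewrite e'E // memv_span ?codom_f.
- by move=> i j; apply: gram.
- by move=> i; rewrite (pow_isom _ phiQ) (pow_isom _ psiQ).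
exists s; split=> // [x xW|a]; last first.
  by rewrite -(pow0 phi (g a)) eE // se -e'E // pow0.
apply/eqP; rewrite -subr_eq0 -!comp_lfunE -opp_lfunE -add_lfunE -memv_ker.
apply: subvP xW; apply: subv_trans gen_cyc _; apply/subv_sumP => a _.
apply/span_subvP => z /mapP[i + ->]; rewrite mem_iota => /andP[_ lt_in].
rewrite memv_ker add_lfunE opp_lfunE !comp_lfunE -powS eE // se -e'E //.
by rewrite (eE a i) 1?ltnW // se -e'E 1?ltnW // powS subrr.
Qed.

(** On [W] the square of [s] commutes with [phi] and fixes the generators. *)
Lemma inverts_intro s : isom s -> (forall x, x \in perp W -> s x = x) ->
  (forall x, x \in W -> s (phi x) = psi (s x)) -> (forall a, s (g a) = g' a) ->
  (forall a, s (g' a) = g a) -> inverts W s.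
Proof.
move=> sQ sp sphi sg sg'.
have sW : stable s W.
  rewrite -(perp_perp W); apply: stable_perp => //.
  by apply/stableP => x xW; rewrite sp.
have pW := stableP _ _ phiW; have qW := stableP _ _ (stable_psi phiW).
have spsi x : x \in W -> s (psi x) = phi (s x).
  by move=> xW; rewrite -{2}(psiK x) sphi ?psiK ?qW.
have ssW x : x \in W -> s (s x) = x.
  have [_ genU] := genW.
  suff /subvP sub : (W <= W :&: fixedSpace (s \o s))%VS.
    by move/sub/memv_capP => [_ /fixedSpaceP]; rewrite comp_lfunE.
  apply: genU => [|a]; last first.
    rewrite memv_cap; have [-> _] := genW.
    by apply/fixedSpaceP; rewrite comp_lfunE sg sg'.
  apply/stableP => z; rewrite !memv_cap => /andP[zW /fixedSpaceP].
  rewrite comp_lfunE => zs; rewrite pW //=; apply/fixedSpaceP.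
  by rewrite comp_lfunE sphi // spsi ?zs // (stableP _ _ sW).
split=> // [x|x xW].
  have : x \in (W + perp W)%VS by rewrite addv_perp ?memvf.
  by case/memv_addP => w wW [p pp ->]; rewrite !linearD /= ssW // !sp ?sp.
rewrite sphi ?(stableP _ _ sW) ?pW // ssW ?pW //; exact: phiK.
Qed.

End Inverter.

(** * Relations between phi - 1, rho and the polar form *)

Lemma N_eq0 x : (N x == 0) = (phi x == x).
Proof. by rewrite shiftE eq_add2. Qed.

Lemma phiN x : phi (N x) = N (phi x).
Proof. by rewrite !shiftE linearD. Qed.

Lemma psiN x : psi (N x) = N (psi x).
Proof. by rewrite !shiftE linearD /= phiK psiK. Qed.

Lemma N'E x : N' x = psi (N x).
Proof. by rewrite !shiftE linearD /= phiK addrC. Qed.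

(** As [psi] is invertible, on a stable subspace [rho] is injective exactly when [phi] has no
    nonzero fixed vector, and nilpotent exactly when [phi] is unipotent. *)
Lemma rhoN x : rho x = psi (N (N x)).
Proof. by rewrite -N'N N'E. Qed.

Lemma phi_rho x : rho (phi x) = phi (rho x).
Proof. by rewrite !rhoE linearD /= phiK psiK. Qed.

Lemma psi_rho x : rho (psi x) = psi (rho x).
Proof. by rewrite !rhoE linearD /= phiK psiK. Qed.

Lemma pow_N' k x : pow N' k x = pow psi k (pow N k x).
Proof.
elim: k => [|k IHk]; first by rewrite !pow0.
rewrite !powS IHk N'E; congr (psi _).
by rewrite (pow_comm _ _ (fun z => psiN z)).
Qed.

Lemma pow_rho k x : pow rho k x = pow psi k (pow N k.*2 x).
Proof.
elim: k => [|k IHk]; first by rewrite !pow0.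
rewrite doubleS !powS IHk rhoN; congr (psi _).
by rewrite !(pow_comm _ _ psiN).
Qed.

Lemma pow_psi_eq0 k x : (pow psi k x == 0) = (x == 0).
Proof.
apply/eqP/eqP => [|->]; last by rewrite linear0.
exact: isom_inj (pow_isom k psiQ).
Qed.

Lemma pow_N'N k x : pow N' k (pow N k x) = pow rho k x.
Proof. by rewrite pow_N' pow_rho -powD addnn. Qed.

Lemma psi_fix x : phi x = x -> psi x = x.
Proof. by move=> px; rewrite -{1}px phiK. Qed.

Lemma pow_fix g k x : g x = x -> pow g k x = x.
Proof. by move=> gx; elim: k => [|k IHk]; rewrite ?pow0 // powS IHk. Qed.

Lemma N_top t x : pow N t.+1 x = 0 -> phi (pow N t x) = pow N t x.
Proof. by rewrite powS => /eqP; rewrite N_eq0 => /eqP. Qed.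

Lemma N'_top t x : pow N t.+1 x = 0 -> pow N' t x = pow N t x.
Proof. by move=> /N_top px; rewrite pow_N' pow_fix ?psi_fix. Qed.

(** On vectors killed by [N^(t+1)], [N^t] agrees with its adjoint [N'^t] because [psi] fixes the
    image; so the top form [B (N^t x) z] is symmetric. *)
Lemma N_top_sym t x z : pow N t.+1 x = 0 -> B (pow N t x) z = B (pow N t z) x.
Proof. by move=> px; rewrite [RHS](pow_adj _ N_adj) N'_top // qpolarC. Qed.

(** Half of the power moves across by self-adjointness, leaving [B z z] or [B (rho z) z]; the latter
    is [B (phi z) z + B (psi z) z], two equal terms. *)
Lemma rho_alt k x : B (pow rho k x) x = 0.
Proof.
rewrite -[k]odd_double_half -addnn powD; set z := pow rho k./2 x.
have zE : pow rho k./2 x = z by [].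
case: (odd k); last by rewrite pow0 powD (pow_adj _ rho_adj) qpolarxx.
rewrite powS pow0 powD -(pow_comm _ _ (fun=> erefl)) (pow_adj _ rho_adj) !zE.
by rewrite rhoE qpolarDl psi_adj [B (phi _) _]qpolarC addrr_pchar2.
Qed.

Lemma pol_rho_alt p x : B (pol rho p x) x = 0.
Proof.
rewrite sum_lfunE qpolar_suml big1 // => i _.
by rewrite scale_lfunE qpolarZl rho_alt mulr0.
Qed.

Lemma stable_phiN W : stable N W -> stable phi W.
Proof.
move/stableP => NW; apply/stableP => x xW.
by rewrite -[phi x](addvK2 x) memvD // addrC -shiftE NW.
Qed.

Lemma cyc_phiN u : cyc phi u = cyc N u.
Proof.
apply/eqP; rewrite eqEsubv !cyc_min ?cyc_gen ?stable_N ?stable_cyc //.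
exact/stable_phiN/stable_cyc.
Qed.

Lemma pow_pol g k p x : pow g k (pol g p x) = pol g p (pow g k x).
Proof. by apply: pow_comm => z; rewrite pol_comm. Qed.

Lemma pol_eq0 g p x : g x = 0 -> pol g p x = p`_0 *: x.
Proof.
move=> gx; elim/poly_ind: p => [|p c _]; first by rewrite pol_0 coef0 scale0r.
by rewrite pol_add pol_mulX gx linear0 pol_polyC add0r coefD coefMX coefC add0r.
Qed.

(** Write the vector with polynomial coefficients in [g]. If some constant term is nonzero, apply
    [g^t]; otherwise all coefficients are divisible by [X], and each [v a] is replaced by [g (v a)]
    with [t] lowered. This reduces nondegeneracy to a test on top vectors. *)
Lemma nilp_top (J : finType) (v : J -> V) g t x :
    (forall a, pow g t.+1 (v a) = 0) ->
    x \in (\sum_a cyc g (v a))%VS -> x != 0 ->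
  exists j, exists2 c : J -> K, exists a, c a != 0 &
    pow g j x = \sum_a c a *: pow g t (v a).
Proof.
move=> gv0 /memv_sumP[z zv ->].
have {zv z} [p -> x0]: exists p : J -> {poly K},
    \sum_a z a = \sum_a pol g (p a) (v a).
  have pE a : exists p, z a == pol g p (v a).
    by have /cycP[p ->] := zv a isT; exists p.
  by exists (fun a => xchoose (pE a)); apply: eq_bigr => a _; apply/eqP/(xchooseP (pE a)).
elim: t v p gv0 x0 => [|t IHt] v p gv0 x0;
  have [/existsP[a pa] | ] := boolP [exists a, (p a)`_0 != 0].
- exists 0%N, (fun b => (p b)`_0); first by exists a.
  rewrite pow0; apply: eq_bigr => b _.
  by rewrite pow0 pol_eq0 // -(pow0 g (v b)) -powS.
- rewrite negb_exists => /forallP p0; case/negP: x0; rewrite big1 // => b _.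
  by rewrite pol_eq0 ?(eqP (negPn (p0 b))) ?scale0r // -(pow0 g (v b)) -powS.
- exists t.+1, (fun b => (p b)`_0); first by exists a.
  rewrite linear_sum /=; apply: eq_bigr => b _.
  by rewrite pow_pol pol_eq0 // -powS gv0.
rewrite negb_exists => /forallP p0.
have pE b : p b = \poly_(i < size (p b)) (p b)`_i.+1 * 'X.
  apply/polyP => -[|i]; rewrite coefMX /= ?(eqP (negPn (p0 b))) // coef_poly.
  by case: ltnP => // le_i; rewrite nth_default // ltnW.
have pvE b : pol g (p b) (v b) = pol g (\poly_(i < size (p b)) (p b)`_i.+1) (g (v b)).
  by rewrite {1}pE pol_mulX.
rewrite (eq_bigr _ (fun b _ => pvE b)) in x0 *.
have [b|j [c c0 jE]] := IHt (fun b => g (v b)) _ _ x0; first by rewrite -powSr.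
exists j, c => //; rewrite jE; apply: eq_bigr => b _; by rewrite -powSr.
Qed.

(** * Unipotent cyclic and bicyclic subspaces *)

Lemma perp_pow_N U j x : stable phi U -> x \in perp U -> pow N j x \in perp U.
Proof.
by move=> phiU; apply/stableP/pow_stable/stable_N; apply: stable_perp.
Qed.

(** A nonzero vector of the radical could be pushed by [N] to a nonzero multiple of [N^t u], which
    is not orthogonal to [u]. *)
Lemma nondeg_cyc t u : pow N t.+1 u = 0 -> B (pow N t u) u != 0 -> nondeg (cyc phi u).
Proof.
move=> uN uu; apply/nondegP => x xU xp; apply/eqP; apply: contraNT uu => x0.
have xS : x \in (\sum_(a : unit) cyc N u)%VS.
  by rewrite (big_pred1 tt) -?cyc_phiN // => -[].
have [j [c [[] c0] jE]] := nilp_top (v := fun=> u) (fun=> uN) xS x0.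
have := perp_pow_N j (stable_cyc phi u) xp.
rewrite jE (big_pred1 tt) => [/perpP/(_ u (cyc_gen _ _))/eqP|[] //].
by rewrite qpolarZl mulf_eq0 (negPf c0).
Qed.

Lemma stable_bicyc u v : stable phi (cyc phi u + cyc phi v).
Proof. by apply: stableD; apply: stable_cyc. Qed.

Section Bicyclic.

Variables (t : nat) (u v : V).
Hypotheses (uN : pow N t.+1 u = 0) (vN : pow N t.+1 v = 0).
Hypotheses (uv : B (pow N t u) v != 0).
Hypotheses (uu : B (pow N t u) u = 0) (vv : B (pow N t v) v = 0).

Let vu : B (pow N t v) u != 0. Proof. by rewrite N_top_sym. Qed.

Lemma nondeg_bicyc : nondeg (cyc phi u + cyc phi v).
Proof.
apply/nondegP => x xU xp; apply/eqP/contraT => x0.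
pose g b := if b then u else v.
have xS : x \in (\sum_(b : bool) cyc N (g b))%VS by rewrite big_bool /= -!cyc_phiN.
have gN b : pow N t.+1 (g b) = 0 by case: b.
have [j [c [b c0] jE]] := nilp_top gN xS x0.
have := perp_pow_N j (stable_bicyc u v) xp.
rewrite jE big_bool /= => /perpP xp'.
have := xp' u (subvP (addvSl _ _) _ (cyc_gen _ _)).
have := xp' v (subvP (addvSr _ _) _ (cyc_gen _ _)).
rewrite !qpolarDl !qpolarZl uu vv !mulr0 add0r addr0 => /eqP + /eqP.
by rewrite !mulf_eq0 (negPf uv) (negPf vu) !orbF; case: b c0 => /negPf->.
Qed.

Lemma pow_N_free (a b : K) : a *: pow N t u + b *: pow N t v = 0 -> a = 0 /\ b = 0.
Proof.
move=> ab0; have := qpolar0l u; have := qpolar0l v; rewrite -ab0 !qpolarDl !qpolarZl uu vv.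
rewrite !mulr0 add0r addr0 => /eqP + /eqP.
by rewrite !mulf_eq0 (negPf uv) (negPf vu) !orbF => /eqP + /eqP.
Qed.

End Bicyclic.

Lemma dim_cyc_le t u : pow N t u = 0 -> (\dim (cyc phi u) <= t)%N.
Proof.
rewrite cyc_phiN; elim: t u => [|t IHt] u; rewrite ?pow0.
  move=> ->; rewrite leqn0 dimv_eq0 -subv0; apply: cyc_min; last exact: mem0v.
  by apply/stableP => x; rewrite memv0 => /eqP->; rewrite linear0 mem0v.
rewrite powSr => /IHt le_t; have sub : (cyc N u <= <[u]> + cyc N (N u))%VS.
  apply: cyc_min; last by rewrite memvE addvSl.
  apply/stableP => _ /memv_addP[_ /vlineP[a ->] [x xN ->]].
  rewrite linearD linearZ /= (subvP (addvSr _ _)) // memvD //.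
    by rewrite memvZ ?cyc_gen.
  by rewrite (stableP _ _ (stable_cyc _ _)).
apply: leq_trans (dimvS sub) _; apply: leq_trans (dimv_add_leqif _ _) _.
by rewrite dim_vline -add1n leq_add ?leq_b1.
Qed.

Lemma dim_two_lines x z : (forall a b, a *: x + b *: z = 0 -> a = 0 /\ b = 0) ->
  \dim (<[x]> + <[z]>) = 2%N.
Proof.
move=> free; have x0 : x != 0.
  apply/eqP => x0; have [|/eqP] := free 1 0; last by rewrite oner_eq0.
  by rewrite x0 scaler0 scale0r addr0.
have z0 : z != 0.
  apply/eqP => z0; have [|_ /eqP] := free 0 1; last by rewrite oner_eq0.
  by rewrite z0 scaler0 scale0r addr0.
rewrite dimv_disjoint_sum ?dim_vline ?x0 ?z0 //.
apply/eqP; rewrite -subv0; apply/subvP => _ /memv_capP[/vlineP[a ->]].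
move=> /vlineP[b abE]; have [|-> _] := free a (- b); last by rewrite scale0r mem0v.
by rewrite abE scaleNr subrr.
Qed.

Lemma dim_bicyc_step t u v U : stable N U -> u \in U -> v \in U ->
    pow N t.+1 u = 0 -> pow N t.+1 v = 0 ->
    (forall a b, a *: pow N t u + b *: pow N t v = 0 -> a = 0 /\ b = 0) ->
  (2 + \dim (N @: U) <= \dim U)%N.
Proof.
move=> NU uU vU uN vN /dim_two_lines d2.
rewrite -[X in (_ <= X)%N](limg_ker_dim N U) leq_add2r -d2 dimvS //.
rewrite subv_cap !subv_add -!memvE !memv_ker -!powS uN vN !eqxx.
by rewrite !(stableP _ _ (pow_stable _ NU)).
Qed.

Lemma dim_bicyc_ge t u v : pow N t.+1 u = 0 -> pow N t.+1 v = 0 ->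
    (forall a b, a *: pow N t u + b *: pow N t v = 0 -> a = 0 /\ b = 0) ->
  (t.+1.*2 <= \dim (cyc N u + cyc N v))%N.
Proof.
elim: t u v => [|t IHt] u v uN vN free; set U := (cyc N u + cyc N v)%VS.
all: have uU : u \in U by apply: subvP (addvSl _ _) _ (cyc_gen _ _).
all: have vU : v \in U by apply: subvP (addvSr _ _) _ (cyc_gen _ _).
all: have NU : stable N U by apply: stableD; apply: stable_cyc.
all: apply: leq_trans (dim_bicyc_step NU uU vU uN vN free).
  by rewrite leq_addr.
have stN : stable N (N @: U) by apply: limgS.
rewrite -[t.+2]add1n doubleD; apply: leq_add => //.
apply: leq_trans (IHt (N u) (N v) _ _ _) (dimvS _); rewrite -?powSr //.
by rewrite subv_add !cyc_min ?memv_img.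
Qed.

Lemma dim_bicyc t u v : pow N t.+1 u = 0 -> pow N t.+1 v = 0 ->
    B (pow N t u) v != 0 -> B (pow N t u) u = 0 -> B (pow N t v) v = 0 ->
  \dim (cyc phi u + cyc phi v) = t.+1.*2.
Proof.
move=> uN vN uv uu vv; apply/eqP; rewrite eqn_leq; apply/andP; split.
  apply: leq_trans (dimv_add_leqif _ _) _.
  by rewrite -addnn leq_add ?dim_cyc_le.
rewrite !cyc_phiN dim_bicyc_ge // => a b; exact: pow_N_free.
Qed.

(** Here [shift phi W] is all of [\dim W], and it is at most the sum of the shifts of [s] and
    [s \o phi], each at most half of [\dim W]; so both equal the half. *)
Lemma parity_free W s : nondeg W -> stable phi W -> stable s W -> isom s ->
    (forall x, s (s x) = x) -> (forall x, x \in W -> s (phi (s (phi x))) = x) ->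
    (W :&: lker N = 0)%VS ->
  (shift s W).*2 = \dim W /\ ~~ odd (shift s W + shift (s \o phi)%VF W + shift phi W).
Proof.
move=> ndW phiW /stableP stW sQ sK sphi kerN; have pW := stableP _ _ phiW.
have spQ : isom (s \o phi)%VF by move=> x; rewrite comp_lfunE sQ phiQ.
have spW : stable (s \o phi)%VF W.
  by apply/stableP => x xW; rewrite comp_lfunE stW ?pW.
have spK x : x \in W -> (s \o phi)%VF ((s \o phi)%VF x) = x.
  by move=> xW; rewrite !comp_lfunE sphi.
have a_le := shift_involution_half sQ (introT (stableP _ _) stW) (fun x _ => sK x) ndW.
have b_le := shift_involution_half spQ spW spK ndW.
have c_le := shift_comp phi W sK.
have cE : shift phi W = \dim W by rewrite /shift (limg_dim_eq kerN).
move: a_le b_le c_le cE; rewrite -!muln2.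
move: (shift s W) (shift _ W) (shift phi W) (\dim W) => a b c d; clear; lia.
Qed.

Lemma anti_pow_N W s k x : stable phi W ->
    (forall z, z \in W -> s (phi z) = psi (s z)) -> x \in W ->
  s (pow N k x) = pow N' k (s x).
Proof.
move=> phiW sphi xW; elim: k => [|k IHk]; first by rewrite !pow0.
rewrite !powS -IHk [in LHS]shiftE linearD /= sphi ?shiftE //.
by rewrite (stableP _ _ (pow_stable _ (stable_N phiW))).
Qed.

(** * Counting fixed vectors of inverting involutions *)

Section Counting.

Variables (W : {vspace V}) (s : 'End(V)).
Hypotheses (ndW : nondeg W) (phiW : stable phi W) (sW : inverts W s).

Lemma inverts_phi x : x \in W -> s (phi x) = psi (s x).
Proof.
case: (sW) => _ sK _ sphi xW.
by rewrite -[s (phi x)]phiK -{2}(sphi x xW) sK.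
Qed.

Lemma inverts_top t x : x \in W -> pow N t.+1 x = 0 -> s x = x \/ s x = phi x ->
  s (pow N t x) = pow N t x.
Proof.
move=> xW xN sx; rewrite (anti_pow_N t phiW inverts_phi) //; case: sx => ->; first exact: N'_top.
have phiNt k : pow N k (phi x) = phi (pow N k x).
  by rewrite (pow_comm _ _ (fun z => esym (phiN z))).
by rewrite N'_top phiNt ?xN ?linear0 // N_top.
Qed.

(** In most uses the upper bounds obtained from [D] and [E] add up to exactly [shift phi W], which
    determines both shifts. *)
Lemma shift_counts D E : (D <= W)%VS -> nondeg D -> (E <= W)%VS -> nondeg E ->
    (forall x, x \in D -> s x = x) -> (forall x, x \in E -> s (phi x) = x) ->
  [/\ (shift s W).*2 + \dim D <= \dim W,
      (shift (s \o phi)%VF W).*2 + \dim E <= \dim W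
    & shift phi W <= shift s W + shift (s \o phi)%VF W]%N.
Proof.
move=> sDW ndD sEW ndE fixD fixE.
have pW := stableP _ _ phiW; have stW := inverts_stable sW.
case: (sW) => sQ sK sp sphi.
have spW : stable (s \o phi)%VF W.
  by apply/stableP => x xW; rewrite comp_lfunE (stableP _ _ stW) ?pW.
split; last exact: shift_comp.
  exact: (shift_involution sQ stW (fun x _ => sK x) ndW sDW ndD fixD).
apply: (shift_involution _ spW _ ndW sEW ndE) => [x|x xW|x xE].
- by rewrite comp_lfunE sQ phiQ.
- by rewrite !comp_lfunE sphi.
- by rewrite comp_lfunE fixE.
Qed.

End Counting.

Lemma nondeg0 : nondeg 0.
Proof. by apply/eqP; rewrite cap0v. Qed.

Lemma lines_le W x z : x \in W -> z \in W -> (<[x]> + <[z]> <= W)%VS.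
Proof. by move=> xW zW; rewrite subv_add -!memvE xW. Qed.

Lemma lines_fix g x z : g x = x -> g z = z ->
  forall y, y \in (<[x]> + <[z]>)%VS -> g y = y.
Proof.
move=> gx gz _ /memv_addP[_ /vlineP[a ->] [_ /vlineP[b ->] ->]].
by rewrite linearD !linearZ /= gx gz.
Qed.

(** The involution [u |-> u] fixes the plane spanned by [u] and its top vector; for [u |-> phi u]
    this plane is fixed by [s' \o phi] instead. As [phi - 1] has rank [\dim W - 1], the two
    involutions have the consecutive shifts [\dim W / 2 - 1] and [\dim W / 2]. *)
Lemma split_parity_cyc t u e : pow N t.+1 u = 0 -> B (pow N t u) u != 0 ->
  split_parity (cyc phi u) e.
Proof.
move=> uN uu; set W := cyc phi u.
have ndW : nondeg W by apply: nondeg_cyc uN uu.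
have phiW : stable phi W by apply: stable_cyc.
have uW : u \in W by apply: cyc_gen.
have NW k : pow N k u \in W by rewrite (stableP _ _ (pow_stable _ (stable_N phiW))).
have [ndD dD] := nondeg_plane uu; have leD := lines_le (NW t) uW.
have cE : (shift phi W).+1 = \dim W.
  apply/eqP; rewrite eqn_leq; apply/andP; split.
    rewrite -[X in (_ <= X)%N](limg_ker_dim N W) -add1n leq_add2r lt0n dimv_eq0.
    apply: contraNneq uu => ker0; have : pow N t u \in (W :&: lker N)%VS.
      by rewrite memv_cap NW memv_ker -powS uN /=.
    by rewrite ker0 memv0 => /eqP->; rewrite qpolar0l.
  have sub : (W <= <[u]> + N @: W)%VS.
    apply: cyc_min; last by rewrite memvE addvSl.
    apply/stableP => x xW; rewrite -[phi x](addvK2 x) addrC [x + phi x]addrC -shiftE.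
    rewrite memvD // (subvP (addvSr _ _)) //; rewrite memv_img //.
    move: xW; apply/subvP; rewrite subv_add -memvE uW.
    exact: stable_N.
  apply: leq_trans (dimvS sub) _; apply: leq_trans (dimv_add_leqif _ _) _.
  by rewrite dim_vline -add1n leq_add ?leq_b1.
have even_d := even_dim_nd ndW.
have genu : generates (fun=> u : V) W (J := unit).
  by split=> // U phiU /(_ tt) uU; apply: cyc_min.
have genpu : generates (fun=> phi u : V) W (J := unit).
  split=> [_|U phiU /(_ tt) uU]; first by rewrite (stableP _ _ phiW).
  by apply: cyc_min => //; rewrite -[u]phiK (stableP _ _ (stable_psi phiU)).
have [s [sW a_s b_s]] : exists s, [/\ inverts W s,
    (shift s W).+1.*2 = \dim W & (shift (s \o phi)%VF W).*2 = \dim W].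
  have [//|a b k|s [sQ sp sphi /(_ tt) su]] := inverter_exists ndW phiW genu genu.
    by rewrite qpolarC.
  have sW : inverts W s by apply: (@inverts_intro _ _ (fun=> u) W ndW phiW genu s sQ sp sphi).
  exists s; have := shift_counts ndW phiW sW leD ndD (sub0v _) nondeg0.
  have sNu : s (pow N t u) = pow N t u by apply: (inverts_top phiW sW) => //; rewrite su; left.
  move=> /(_ (lines_fix sNu su)); rewrite dD dimv0 addn0.
  case=> [x|]; first by rewrite memv0 => /eqP->; rewrite !linear0.
  move=> le1 le2 le3; split=> //; move: cE le1 le2 le3;
    by move: (shift s W) (shift _ W) (shift phi W) (\dim W) => a b c d; clear; lia.
have [s' [sW' a_s' b_s']] : exists s, [/\ inverts W s,
    (shift s W).*2 = \dim W & (shift (s \o phi)%VF W).+1.*2 = \dim W].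
  have [_|a b k|s' [sQ sp sphi /(_ tt) su]] := inverter_exists ndW phiW genu genpu.
  - by rewrite phiQ.
  - by rewrite (pow_comm _ _ (fun=> erefl)) (isomB _ _ phiQ) qpolarC.
  have spu : s' (phi u) = u by rewrite sphi // su phiK.
  have sW' : inverts W s' by apply: (@inverts_intro _ _ (fun=> phi u) W ndW phiW genu s' sQ sp sphi).
  exists s'; have := shift_counts ndW phiW sW' (sub0v _) nondeg0 leD ndD.
  have sNu : s' (phi (pow N t u)) = pow N t u.
    by rewrite N_top //; apply: (inverts_top phiW sW') => //; rewrite su; right.
  rewrite dD dimv0 addn0; case=> [x||].
  - by rewrite memv0 => /eqP->; rewrite linear0.
  - by move=> x xD; have := lines_fix (g := (s' \o phi)%VF) _ _ xD;
       rewrite !comp_lfunE sNu spu; apply.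
  move=> le1 le2 le3; split=> //; move: cE le1 le2 le3;
    by move: (shift s' W) (shift _ W) (shift phi W) (\dim W) => a b c d; clear; lia.
move: cE even_d a_s b_s a_s' b_s'.
have [<-|ne] := eqVneq (odd (shift s W)) e.
  exists s; split=> //; move: cE a_s b_s.
  move: (shift s W) (shift _ W) (shift phi W) (\dim W) => a b c d; clear; lia.
exists s'; split=> //.
  move: ne a_s a_s'; move: (shift s W) (shift s' W) (\dim W) => a b d.
  by case: e; clear; lia.
move: cE a_s' b_s'.
move: (shift s' W) (shift _ W) (shift phi W) (\dim W) => a b c d; clear; lia.
Qed.

(** Both [phi] and [psi] are roots of [X^2 = rho X + 1], so the same polynomials serve for both. In
    particular [phi^k + psi^k] is [rho] times an element of [K[rho]]. *)
Lemma phi_pow_rho k : exists p q, forall z,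
  pow phi k z = pol rho p z + phi (pol rho q z) /\
  pow psi k z = pol rho p z + psi (pol rho q z).
Proof.
have phi2 z : phi (phi z) = phi (rho z) + z.
  by rewrite rhoE linearD /= psiK -addrA addvv2 addr0.
have psi2 z : psi (psi z) = psi (rho z) + z.
  by rewrite rhoE linearD /= phiK addrAC addvv2 add0r.
elim: k => [|k [p [q IHk]]].
  by exists 1%:P, 0 => z; rewrite !pow0 pol_polyC scale1r pol_0 !linear0 addr0.
exists q, (p + 'X * q) => z; have [e1 e2] := IHk z.
rewrite !powS e1 e2 !linearD /= phi2 psi2 !pol_add !pol_mul !pol_X !linearD /=.
by split; rewrite addrA addrC.
Qed.

Lemma separation W Y x : nondeg W -> (Y <= W)%VS -> x \in W -> x \notin Y ->
  exists v, [/\ v \in W, forall y, y \in Y -> B y v = 0 & B x v != 0].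
Proof.
move=> ndW sYW xW; rewrite -{1}(perp_perp_in ndW sYW) memv_cap xW /=.
case/mem_orthovPn => v /memv_capP[vW /perpP vY] xv; exists v; split=> // y yY.
by rewrite qpolarC vY.
Qed.

(** A power of [rho] takes [x] to a nonzero scalar multiple of [rho^m w], and [N] still kills the
    result. *)
Lemma rho_top m w x : pow rho m.+1 w = 0 -> N x = 0 -> x != 0 ->
  x \in cyc rho w -> N (pow rho m w) = 0.
Proof.
move=> wr Nx x0 xw; have xS : x \in (\sum_(a : unit) cyc rho w)%VS.
  by rewrite (big_pred1 tt) // => -[].
have [j [c [[] c0] jE]] := nilp_top (v := fun=> w) (fun=> wr) xS x0.
have Nrho z : rho (N z) = N (rho z) by rewrite !shiftE linearD /= phi_rho.
move: jE; rewrite (big_pred1 tt) => [/(congr1 N)|[] //].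
rewrite -(pow_comm _ _ Nrho) Nx !linear0 linearZ /= => /esym/eqP.
by rewrite scaler_eq0 (negPf c0) => /eqP.
Qed.

Lemma N_psi_pow k j x : pow N j (pow psi k x) = pow psi k (pow N j x).
Proof.
by apply: esym; apply: pow_comm => z; rewrite -(pow_comm _ _ (fun y => esym (psiN y))).
Qed.

Lemma N_rho_pow m x : N (pow rho m x) = pow psi m (pow N m.*2.+1 x).
Proof. by rewrite pow_rho powS -(pow0 N (N _)) -powSr N_psi_pow powS pow0. Qed.

(** For even block size [t + 1], the last vector of [K[rho] u] is [N^(t-1) u] up to a power of
    [psi], and [N] does not kill it. *)
Lemma top_notin_even t u : odd t -> pow N t.+1 u = 0 -> pow N t u != 0 ->
  pow N t u \notin cyc rho u.
Proof.
move=> t_odd uN u0; have tE : (t./2.*2).+1 = t by rewrite -[RHS]odd_double_half t_odd.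
apply/negP => /(rho_top (m := t./2)); rewrite pow_rho doubleS tE uN linear0.
rewrite -powS uN => /(_ erefl erefl u0) /eqP.
by rewrite N_rho_pow tE pow_psi_eq0 (negPf u0).
Qed.

(** For odd block size [K[rho] u] does contain the top vector, so [u] is replaced by [N' u]: the
    last vector of that module is again [N^(t-1) u] up to a power of [psi]. For [t = 0] the module
    is zero. *)
Lemma top_notin_odd t u : ~~ odd t -> pow N t.+1 u = 0 -> pow N t u != 0 ->
  pow N t u \notin cyc rho (N' u).
Proof.
move=> t_even uN u0; have tE : t./2.*2 = t by rewrite even_halfK.
have [t0|t_gt0] := posnP t.
  move: uN u0; rewrite t0 powS !pow0 N'E => -> u0; rewrite linear0.
  by apply: contra u0 => /cycP[p ->]; rewrite linear0.
have tE1 : ((t./2).-1.*2).+2 = t by rewrite -doubleS prednK // half_gt0; case: (t) t_even t_gt0 => [|[]].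
apply/negP => /(rho_top (m := t./2.-1)).
rewrite N'E !(pow_comm _ _ psi_rho) -psiN N_rho_pow pow_rho doubleS -!powSr.
rewrite tE1 uN !linear0 -powS uN => /(_ erefl erefl u0) /eqP.
by rewrite -powS pow_psi_eq0 (negPf u0).
Qed.

(** * Two Jordan blocks of equal size *)

Section BicyclicParity.

Variables (W : {vspace V}) (t : nat).
Hypotheses (ndW : nondeg W) (phiW : stable phi W).
Hypothesis WN : forall x, x \in W -> pow N t.+1 x = 0.
Hypothesis Walt : forall x, x \in W -> B (pow N t x) x = 0.

Let pW x : x \in W -> phi x \in W. Proof. exact: stableP phiW x. Qed.
Let qW x : x \in W -> psi x \in W. Proof. exact: stableP (stable_psi phiW) x. Qed.
Let NW k x : x \in W -> pow N k x \in W.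
Proof. exact: stableP (pow_stable k (stable_N phiW)) x. Qed.
Let rW x : x \in W -> rho x \in W. Proof. exact: stableP (stable_rho phiW) x. Qed.

Let bicyc_facts u v : u \in W -> v \in W -> B (pow N t u) v != 0 ->
  let U := (cyc phi u + cyc phi v)%VS in
  [/\ [/\ (U <= W)%VS, nondeg U, stable phi U, u \in U & v \in U],
      \dim U = t.+1.*2, shift phi U = t.*2
    & generates (fun b => if b then u else v) U].
Proof.
move=> uW vW uv U.
have uU : u \in U by apply: subvP (addvSl _ _) _ (cyc_gen _ _).
have vU : v \in U by apply: subvP (addvSr _ _) _ (cyc_gen _ _).
have dU : \dim U = t.+1.*2 by apply: dim_bicyc; rewrite ?WN ?Walt.
have stU : stable phi U := stable_bicyc u v.
split=> //.
- split=> //; first by rewrite subv_add !cyc_min.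
  by apply: (nondeg_bicyc (t := t)); rewrite ?WN ?Walt.
- apply/eqP; rewrite eqn_leq; apply/andP; split.
    rewrite -(leq_add2l 2) [in X in (_ <= X)%N]add2n -doubleS -dU.
    apply: (dim_bicyc_step (t := t)) uU vU _ _ _; rewrite ?WN //; first exact: stable_N.
    by move=> a b; apply: pow_N_free; rewrite ?WN ?Walt.
  have sub : (U <= <[u]> + <[v]> + N @: U)%VS.
    have st : stable phi (<[u]> + <[v]> + N @: U).
      apply: stable_phiN; apply/stableP => x xS.
      rewrite (subvP (addvSr _ _)) // memv_img //; apply: subvP xS.
      by rewrite subv_add lines_le //=; apply: stable_N.
    by rewrite subv_add !cyc_min // memvE (subv_trans _ (addvSl _ _)) ?addvSl ?addvSr.
  have := dimvS sub; rewrite dU => /leq_trans/(_ (dimv_add_leqif _ _)).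
  have d2 : (\dim (<[u]> + <[v]>) <= 2)%N.
    apply: leq_trans (dimv_add_leqif _ _) _; rewrite !dim_vline.
    by case: (u != 0); case: (v != 0).
  rewrite doubleS -/(shift phi U) => le1; rewrite -(leq_add2l 2) add2n.
  by apply: leq_trans le1 _; rewrite leq_add2r.
split=> [[]//|X phiX gX]; have uX := gX true; have vX := gX false.
by rewrite subv_add !cyc_min.
Qed.

(** [v] is orthogonal to [K[rho] u], which contains every [phi^k u + psi^k u]; this is the cross
    condition for fixing both generators. Together with their top vectors they span a nondegenerate
    fixed space of dimension 4, which leaves [shift s U = t - 1]. *)
Lemma split_parity_bicyc_even u : odd t -> u \in W -> pow N t u != 0 ->
  exists U, [/\ (U <= W)%VS, nondeg U, stable phi U, \dim U = t.+1.*2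
    & split_parity U false].
Proof.
move=> t_odd uW u0.
have [|v [vW vY uv]] := separation ndW _ (NW t uW) (top_notin_even t_odd (WN uW) u0).
  by rewrite cyc_min ?stable_rho.
have [[sUW ndU phiU uU vU] dU cU genU] := bicyc_facts uW vW uv.
set U := (_ + _)%VS in sUW ndU phiU uU vU dU cU genU; exists U; split=> //.
have cross k : B (pow phi k u) v = B u (pow phi k v).
  rewrite -(pow_adj _ psi_adj); apply/eqP; rewrite -eqk_add2 -qpolarDl.
  have [p [q /(_ u)[-> ->]]] := phi_pow_rho k.
  rewrite addrACA addvv2 add0r -rhoE vY // (stableP _ _ (stable_cyc _ _)) //.
  exact: cyc_pol.
have [//|a b k|s [sQ sp sphi sg]] := inverter_exists ndU phiU genU genU.
  by case: a; case: b => /=; [exact: qpolarC|exact: cross|rewrite qpolarC -cross qpolarC|exact: qpolarC].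
have sU : inverts U s by apply: (inverts_intro ndU phiU genU sQ sp sphi sg sg).
have su : s u = u := sg true; have sv : s v = v := sg false.
have sNu : s (pow N t u) = pow N t u.
  by apply: (inverts_top phiU sU) => //; [exact: WN | left].
have sNv : s (pow N t v) = pow N t v.
  by apply: (inverts_top phiU sU) => //; [exact: WN | left].
have uNv : B u (pow N t v) != 0 by rewrite qpolarC N_top_sym ?WN.
have vNu : B v (pow N t u) != 0 by rewrite qpolarC.
have [nd1 d1] := nondeg_plane uNv; have [nd2 d2] := nondeg_plane vNu.
have NU k x : x \in U -> pow N k x \in U.
  by move=> xU; rewrite (stableP _ _ (pow_stable k (stable_N phiU))).
have NuNv : B (pow N t u) (pow N t v) = 0.
  rewrite qpolarC (pow_adj _ N_adj) N'_top -?powD; last first.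
    by apply: (pow_eq0 (i := t.+1)); rewrite ?WN // ltnS leq_addl.
  by rewrite (pow_eq0 (i := t.+1)) ?qpolar0r ?WN // -addn1 leq_add2l odd_gt0.
have orth : (<[u]> + <[pow N t v]> <= perp (<[v]> + <[pow N t u]>))%VS.
  rewrite perpD subv_cap !subv_add.
  have le a b : B a b = 0 -> (<[a]> <= perp <[b]>)%VS.
    by move=> ab; rewrite -memvE; apply/perpP => _ /vlineP[c ->]; rewrite qpolarZr ab mulr0.
  apply/andP; split; apply/andP; split; apply: le.
  - by rewrite vY ?cyc_gen.
  - exact: Walt.
  - by rewrite qpolarC Walt.
  - by rewrite qpolarC.
have [nd12 d12] := nondeg_orth nd1 nd2 orth.
have le12 : (<[u]> + <[pow N t v]> + (<[v]> + <[pow N t u]>) <= U)%VS.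
  by rewrite subv_add !lines_le ?NU.
have [x|x|] := shift_counts ndU phiU sU le12 nd12 (sub0v _) nondeg0.
- by case/memv_addP => y /(lines_fix su sNv) sy [z /(lines_fix sv sNu) sz ->];
    rewrite linearD /= sy sz.
- by rewrite memv0 => /eqP->; rewrite !linear0.
rewrite d12 d1 d2 dimv0 addn0 => le1 le2 le3; exists s; split=> //.
  move: cU le1 le2 le3 dU t_odd.
  by move: (shift s U) (shift _ U) (shift phi U) (\dim U) (t) => a b c d k; clear; lia.
move: cU le1 le2 le3 dU t_odd.
by move: (shift s U) (shift _ U) (shift phi U) (\dim U) (t) => a b c d k; clear; lia.
Qed.

(** Orthogonality of [v] to [K[rho] (N' u)] is the cross condition for [u |-> u], [v |-> phi v].
    Then [s] fixes [u] and the top vector of [v], and [s \o phi] fixes [v] and the top vector of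
    [u]; both shifts are at most [t], hence equal to [t]. *)
Lemma split_parity_bicyc_odd u : ~~ odd t -> u \in W -> pow N t u != 0 ->
  exists U, [/\ (U <= W)%VS, nondeg U, stable phi U, \dim U = t.+1.*2
    & split_parity U false].
Proof.
move=> t_even uW u0.
have [|v [vW vY uv]] := separation ndW _ (NW t uW) (top_notin_odd t_even (WN uW) u0).
  by rewrite cyc_min ?stable_rho // N'E qW ?(NW 1) // -(pow0 N (N u)) -powSr NW.
have [[sUW ndU phiU uU vU] dU cU genU] := bicyc_facts uW vW uv.
set U := (_ + _)%VS in sUW ndU phiU uU vU dU cU genU; exists U; split=> //.
pose g' (b : bool) := if b then u else phi v.
have genU' : generates g' U.
  split=> [[]|X phiX gX] //; first by rewrite (stableP _ _ phiU).
  have uX : u \in X := gX true; have pvX : phi v \in X := gX false.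
  rewrite subv_add !cyc_min //.
  by rewrite -(phiK v) (stableP _ _ (stable_psi phiX)).
have N'u_pol p : pol rho p u + psi (pol rho p u) \in cyc rho (N' u).
  have -> : pol rho p u + psi (pol rho p u) = pol rho p (N' u).
    by rewrite shiftE linearD /= (pol_comm _ _ psi_rho) addrC.
  exact: cyc_pol.
have cross k : B (pow phi k u) v = B u (pow phi k (phi v)).
  rewrite -(pow_adj _ psi_adj) -psi_adj; apply/eqP; rewrite -eqk_add2 -qpolarDl.
  have [p [q /(_ u)[-> ->]]] := phi_pow_rho k.
  rewrite linearD /= addrACA qpolarDl vY ?N'u_pol // add0r.
  set z := pol rho q u.
  (* This is [phi + psi^2 = (rho + 1) (1 + psi)], with [1 + psi = N']. *)
  have -> : phi z + psi (psi z) = rho (z + psi z) + (z + psi z).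
    rewrite rhoE !linearD /= psiK -[RHS]addrA [psi z + psi _]addrC.
    by rewrite [X in _ = _ + X]addrACA addvv2 addr0 addrACA addvv2 addr0.
  by rewrite qpolarDl !vY ?addr0 ?(stableP _ _ (stable_cyc _ _)) ?N'u_pol.
have cross' k : B (pow phi k v) u = B (phi v) (pow phi k u).
  rewrite qpolarC -(pow_adj _ psi_adj) [RHS]qpolarC -psi_adj.
  apply/eqP; rewrite -eqk_add2 -qpolarDl.
  have [p [q /(_ u)[-> ->]]] := phi_pow_rho k.
  rewrite linearD /= phiK addrACA [psi _ + _]addrC.
  by rewrite qpolarDl !vY ?addr0 ?N'u_pol.
have [b|a b k|s [sQ sp sphi sg]] := inverter_exists ndU phiU genU genU'.
- by case: b; rewrite //= phiQ.
- case: a; case: b => /=; [exact: qpolarC|exact: cross|exact: cross'|].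
  by rewrite (pow_comm _ _ (fun=> erefl)) (isomB _ _ phiQ) qpolarC.
have su : s u = u := sg true; have sv : s v = phi v := sg false.
have spv : s (phi v) = v by rewrite sphi // sv phiK.
have sU : inverts U s.
  by apply: (inverts_intro ndU phiU genU sQ sp sphi sg) => -[].
have sNu : s (pow N t u) = pow N t u.
  by apply: (inverts_top phiU sU) => //; [exact: WN | left].
have sNv : s (pow N t v) = pow N t v.
  by apply: (inverts_top phiU sU) => //; [exact: WN | right].
have spNu : s (phi (pow N t u)) = pow N t u by rewrite N_top ?WN.
have uNv : B u (pow N t v) != 0 by rewrite qpolarC N_top_sym ?WN.
have vNu : B v (pow N t u) != 0 by rewrite qpolarC.
have [nd1 d1] := nondeg_plane uNv; have [nd2 d2] := nondeg_plane vNu.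
have NU k x : x \in U -> pow N k x \in U.
  by move=> xU; rewrite (stableP _ _ (pow_stable k (stable_N phiU))).
have [x|x|] := shift_counts ndU phiU sU (lines_le uU (NU t _ vU)) nd1
  (lines_le vU (NU t _ uU)) nd2.
- exact: lines_fix.
- by move/(lines_fix (g := (s \o phi)%VF)); rewrite !comp_lfunE; apply.
rewrite d1 d2 => le1 le2 le3; exists s; split=> //.
  move: cU le1 le2 le3 dU t_even.
  by move: (shift s U) (shift _ U) (shift phi U) (\dim U) (t) => a b c d k; clear; lia.
move: cU le1 le2 le3 dU t_even.
by move: (shift s U) (shift _ U) (shift phi U) (\dim U) (t) => a b c d k; clear; lia.
Qed.

(** The quadratic map [Q (N^(t/2) x)] has polarization [B (rho^(t/2) x) y]; where this is nonzero,
    the map cannot vanish at all of [x], [y] and [x + y]. *)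
Lemma odd_gen x : ~~ odd t -> x \in W -> pow N t x != 0 ->
  exists u, [/\ u \in W, pow N t u != 0 & Q (pow N t./2 u) != 0].
Proof.
move=> t_even xW x0; have tE : t./2.*2 = t by rewrite even_halfK.
have r0 z : (pow rho t./2 z == 0) = (pow N t z == 0).
  by rewrite pow_rho tE pow_psi_eq0.
have rxW : pow rho t./2 x \in W by rewrite (stableP _ _ (pow_stable _ (stable_rho phiW))).
have [y yW xy] : exists2 y, y \in W & B (pow rho t./2 x) y != 0.
  by apply: (nondeg_sep ndW rxW); rewrite r0.
have y0 : pow N t y != 0.
  by rewrite -r0; apply: contraNneq xy => y0; rewrite (pow_adj _ rho_adj) y0 qpolar0r.
have xy0 : pow N t (x + y) != 0.
  rewrite -r0 linearD /= eq_add2; apply: contraNneq xy => ->.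
  by rewrite rho_alt.
move: xy; rewrite -pow_N'N (pow_adj _ N'_adj) => xy.
have [Qx|Qx] := eqVneq (Q (pow N t./2 x)) 0; last by exists x.
have [Qy|Qy] := eqVneq (Q (pow N t./2 y)) 0; last by exists y.
by exists (x + y); split; rewrite ?memvD // linearD quadD Qx Qy !add0r.
Qed.

(** The values are corrected from [i = m] downwards: adding a multiple of [g^k w] changes the
    pairing at [i = m - k] and none at larger [i]. *)
Lemma prescribe g u w m (c : nat -> K) : (forall x z, B (g x) z = B x (g z)) ->
    stable g W -> w \in W -> pow g m.+1 u = 0 -> B (pow g m u) w != 0 ->
  exists2 v, v \in W & forall i, (i <= m)%N -> B (pow g i u) v = c i.
Proof.
move=> g_adj gW wW gu uw.
suff key k : exists2 v, v \in W & forall i, (m < i + k)%N -> (i <= m)%N ->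
    B (pow g i u) v = c i.
  have [v vW vE] := key m.+1.
  by exists v => // i; apply: vE; rewrite addnS ltnS leq_addl.
elim: k => [|k [v vW vE]].
  by exists 0; rewrite ?mem0v // => i; rewrite addn0 ltnNge => /negP lt_mi /lt_mi.
have [lt_mk|le_km] := ltnP m k.
  exists v => // i _; apply: vE; exact: leq_trans lt_mk (leq_addl _ _).
pose d := (c (m - k)%N - B (pow g (m - k) u) v) / B (pow g m u) w.
exists (v + d *: pow g k w) => [|i lt_m le_m].
  by rewrite memvD ?memvZ ?(stableP _ _ (pow_stable _ gW)).
rewrite qpolarDr qpolarZr -(pow_adj _ g_adj) -powD.
have [->|ne] := eqVneq i (m - k)%N.
  by rewrite subnKC // divfK // addrC subrK.
rewrite vE //; last by move: lt_m le_m le_km ne; clear; lia.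
rewrite (pow_eq0 _ gu) ?qpolar0l ?mulr0 ?addr0 //.
by move: lt_m le_m le_km ne; clear; lia.
Qed.

Lemma quadN x : Q (N x) = B (phi x) x.
Proof. by rewrite shiftE quadD phiQ addrr_pchar2 // add0r. Qed.

Lemma quad_powN k x : Q (pow N k.+1 x) = B (phi (pow rho k x)) x.
Proof.
rewrite powS quadN -(pow_comm _ _ (fun z => esym (phiN z))) (pow_adj _ N_adj).
by rewrite pow_N'N -(pow_adj _ rho_adj) (pow_comm _ _ phi_rho).
Qed.

(* A vector [v] such that exchanging [v] and [v + u] extends to an involution
   inverting [phi]. *)
Lemma swap_generator u : ~~ odd t -> u \in W -> pow N t u != 0 ->
    Q (pow N t./2 u) != 0 ->
  exists v, [/\ v \in W, B (pow N t u) v != 0, B u v = Q u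
    & forall k, B (pow phi k u + pow psi k u) v = B (pow phi k u) u].
Proof.
move=> t_even uW u0 Qu; set m := t./2 in Qu; have tE : m.*2 = t by rewrite even_halfK.
(* By [quad_powN], [c i] is [Q (N^i u)]. The value at 0 makes [Q (v + u) = Q v]; the others give the
   cross condition, since [phi^k + psi^k] is [rho] times a polynomial in [rho]. The value at [m] is
   nonzero by the choice of [u], so [u] and [v] pair at the top. *)
pose c i := if i is j.+1 then B (phi (pow rho j u)) u else Q u.
have cm : c m != 0 by move: Qu; rewrite /c; case: (m) => [|k]; rewrite ?pow0 // quad_powN.
have ru : pow rho m.+1 u = 0.
  by rewrite pow_rho doubleS tE (pow_eq0 (leqnSn _) (WN uW)) linear0.
have rm : pow rho m u = pow N t u.
  by rewrite pow_rho tE pow_fix //; apply/psi_fix/N_top/WN.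
have [w wW uw] := nondeg_sep ndW (NW t uW) u0; rewrite -rm in uw.
have [v vW vE] := prescribe c rho_adj (stable_rho phiW) wW ru uw.
have cE i : B (pow rho i u) v = c i.
  have [/vE//|lt_mi] := leqP i m; rewrite (pow_eq0 lt_mi ru) qpolar0l /c.
  case: i lt_mi => // j; rewrite ltnS leq_eqVlt => /predU1P[<-|lt_mj].
    by rewrite rm N_top ?WN // Walt.
  by rewrite (pow_eq0 lt_mj ru) linear0 qpolar0l.
exists v; split=> //; first by rewrite -rm cE.
  by have := cE 0%N; rewrite pow0.
have rhoE' p : B (rho (pol rho p u)) v = B (phi (pol rho p u)) u.
  rewrite !sum_lfunE !linear_sum /= !qpolar_suml; apply: eq_bigr => i _.
  by rewrite !scale_lfunE !linearZ /= !qpolarZl -powS cE.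
move=> k; have [p [q /(_ u)[-> ->]]] := phi_pow_rho k.
by rewrite addrACA addvv2 add0r -rhoE rhoE' qpolarDl pol_rho_alt add0r.
Qed.

(** The involution exchanges the complementary submodules generated by [v] and [v + u], so it fixes
    no nonzero vector of either, and its shift reaches [t + 1], half of [\dim U], an odd number. *)
Lemma split_parity_bicyc_swap u : ~~ odd t -> u \in W -> pow N t u != 0 ->
    Q (pow N t./2 u) != 0 ->
  exists U, [/\ (U <= W)%VS, nondeg U, stable phi U, \dim U = t.+1.*2
    & split_parity U true].
Proof.
move=> t_even uW u0 Qu.
have [v [vW uv uvQ cross]] := swap_generator t_even uW u0 Qu.
have vvu : B (pow N t v) (v + u) != 0.
  by rewrite qpolarDr Walt // add0r N_top_sym ?WN.
have [[sUW ndU phiU vU vuU] dU cU genU] := bicyc_facts vW (memvD vW uW) vvu.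
set C := cyc phi v in sUW ndU phiU vU vuU dU cU genU.
set C' := cyc phi (v + u) in sUW ndU phiU vU vuU dU cU genU.
set U := (C + C')%VS in sUW ndU phiU vU vuU dU cU genU; exists U; split=> //.
pose g' (b : bool) := if b then v + u else v.
have genU' : generates g' U.
  split=> [[]|X phiX gX] //.
  have vX : v \in X := gX false; have vuX : v + u \in X := gX true.
  by rewrite subv_add !cyc_min.
have cross' k : B (pow phi k v) v = B (v + u) (pow phi k (v + u)).
  rewrite linearD /= qpolarDl !qpolarDr [B v _]qpolarC [B v (pow phi k u)]qpolarC.
  rewrite -(pow_adj k psi_adj u v) [B u (pow phi k u)]qpolarC -cross qpolarDl.
  by rewrite [X in _ = _ + X]addrCA addrr_pchar2 // addr0 -addrA addrr_pchar2 ?addr0.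
have [b|a b k|s [sQ sp sphi sg]] := inverter_exists ndU phiU genU genU'.
- by case: b; rewrite /= quadD [B v u]qpolarC uvQ -addrA addrr_pchar2 ?addr0.
- case: a; case: b => /=; [exact: cross'|exact: qpolarC|exact: qpolarC|].
  by rewrite qpolarC -cross' qpolarC.
have sv : s v = v + u := sg true; have svu : s (v + u) = v := sg false.
have sU : inverts U s.
  by apply: (inverts_intro ndU phiU genU sQ sp sphi sg) => -[].
have dC : (\dim C <= t.+1)%N by apply: dim_cyc_le; rewrite WN.
have dC' : (\dim C' <= t.+1)%N by apply: dim_cyc_le; rewrite WN ?memvD.
have dCC' := dimv_sum_cap C C'; rewrite -/U dU in dCC'.
have [dCE CC'0] : \dim C = t.+1 /\ (C :&: C' = 0)%VS.
  have [-> /eqP] : \dim C = t.+1 /\ \dim (C :&: C') = 0%N.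
    move: dC dC' dCC'; move: (\dim C) (\dim C') (\dim (C :&: C')) (t) => a b c k.
    by clear; lia.
  by rewrite dimv_eq0 => /eqP.
have sC x : x \in C -> s x \in C'.
  have /subvP sub : (C <= U :&: s @^-1: C')%VS; last first.
    by move/sub/memv_capP => [_]; rewrite memv_preim.
  apply: cyc_min; last by rewrite memv_cap vU -memv_preim sv cyc_gen.
  apply/stableP => z; rewrite !memv_cap -!memv_preim => /andP[zU szC].
  rewrite (stableP _ _ phiU) //= sphi // (stableP _ _ (stable_psi _)) //.
  exact: stable_cyc.
have shift_ge h : (forall x, x \in C -> h x \in C') -> (t.+1 <= shift h U)%N.
  move=> hC; rewrite -dCE; have <- : \dim ((h - \1)%VF @: C) = \dim C.
    apply: limg_dim_eq; apply/eqP; rewrite -subv0 -CC'0; apply/subvP => x.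
    move=> /memv_capP[xC]; rewrite memv_ker shiftE eq_add2 => /eqP hx.
    by rewrite memv_cap xC -hx hC.
  by rewrite dimvS ?limgS ?addvSl.
have a_ge := shift_ge s sC.
have b_ge : (t.+1 <= shift (s \o phi)%VF U)%N.
  by apply: shift_ge => x xC; rewrite comp_lfunE sC // (stableP _ _ (stable_cyc _ _)).
have fix0 g x : x \in 0%VS -> g x = x by rewrite memv0 => /eqP->; rewrite linear0.
have [x /fix0//|x|] := shift_counts ndU phiU sU (sub0v _) nondeg0 (sub0v _) nondeg0.
  by rewrite memv0 => /eqP->; rewrite !linear0.
rewrite dimv0 !addn0 => le1 le2 _; exists s; split=> //.
  move: cU a_ge le1 dU t_even.
  by move: (shift s U) (shift phi U) (\dim U) (t) => a c d k; clear; lia.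
move: cU a_ge b_ge le1 le2 dU t_even.
by move: (shift s U) (shift _ U) (shift phi U) (\dim U) (t) => a b c d k; clear; lia.
Qed.

End BicyclicParity.

(** * Indecomposable subspaces *)

Definition indec W := W != 0%VS /\
  forall U, (U <= W)%VS -> nondeg U -> stable phi U -> U != 0%VS -> U = W.

Lemma ker_pow_stable g W : exists2 k, (0 < k)%N &
  forall x, x \in W -> pow g (k + k) x = 0 -> pow g k x = 0.
Proof.
pose K' k := (W :&: lker (pow g k))%VS.
suff [k k_gt0 sub] : exists2 k, (0 < k)%N & (K' (k + k)%N <= K' k)%VS.
  exists k => // x xW gx; have := subvP sub x; rewrite !memv_cap xW !memv_ker gx eqxx.
  by move=> /(_ isT)/eqP.
suff key n k : (0 < k)%N -> (\dim W - \dim (K' k) < n)%N ->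
    exists2 k, (0 < k)%N & (K' (k + k)%N <= K' k)%VS.
  by have [n] := ubnP (\dim W - \dim (K' 1%N)); apply: key.
elim: n k => // n IHn k k_gt0 le_n.
have [sub|nsub] := boolP (K' (k + k)%N <= K' k)%VS; first by exists k.
have s2 : (K' k <= K' (k + k)%N)%VS.
  apply/subvP => x; rewrite !memv_cap !memv_ker => /andP[-> /eqP gx].
  by rewrite (pow_eq0 _ gx) ?leq_addr //=.
have lt_d : (\dim (K' k) < \dim (K' (k + k)%N))%N.
  by rewrite (ltn_leqif (dimv_leqif_sup s2)).
have le_d : (\dim (K' (k + k)%N) <= \dim W)%N by rewrite dimvS ?capvSl.
apply: (IHn (k + k)%N); first by rewrite addn_gt0 k_gt0.
move: le_n lt_d le_d; move: (\dim _) (\dim (K' k)) (\dim (K' _)) => a b c.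
by clear; lia.
Qed.

(** The Fitting null component: by self-adjointness its orthogonal in [W] is the image of [g^k], and
    the two meet trivially once the kernels are stationary. *)
Lemma fitting g W : (forall x z, B (g x) z = B x (g z)) ->
    (forall x, phi (g x) = g (phi x)) -> nondeg W -> stable phi W -> stable g W ->
  exists k, [/\ (0 < k)%N, nondeg (W :&: lker (pow g k)) &
    stable phi (W :&: lker (pow g k))].
Proof.
move=> g_adj phig ndW phiW gW; have [k k_gt0 kk] := ker_pow_stable g W.
exists k; split=> //; last first.
  apply/stableP => x; rewrite !memv_cap !memv_ker => /andP[xW /eqP gx].
  rewrite (stableP _ _ phiW) //=; apply/eqP.
  by rewrite (pow_comm _ _ (fun z => esym (phig z))) gx linear0.
set U := (W :&: _)%VS; have sUW : (U <= W)%VS := capvSl _ _.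
have gkW : stable (pow g k) W := pow_stable k gW.
have perpU : (W :&: perp U = pow g k @: W)%VS.
  apply/eqP; rewrite eq_sym eqEdim; apply/andP; split.
    rewrite subv_cap [X in X && _]gkW; apply/subvP => _ /memv_imgP[x xW ->].
    apply/perpP => z /memv_capP[_]; rewrite memv_ker => /eqP gz.
    by rewrite (pow_adj _ g_adj) gz qpolar0r.
  have := dim_perp_in ndW sUW; have := limg_ker_dim (pow g k) W; rewrite -/U.
  move: (\dim _) (\dim _) (\dim _) (\dim _) => a b c d; clear; lia.
apply/nondegP => x xU xp; have : x \in (W :&: perp U)%VS.
  by rewrite memv_cap (subvP sUW).
rewrite perpU => /memv_imgP[z zW xE]; move: xU; rewrite memv_cap memv_ker.
by rewrite xE -powD => /andP[_ /eqP/kk->].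
Qed.

Lemma indec_nilp_or_inj g W : (forall x z, B (g x) z = B x (g z)) ->
    (forall x, phi (g x) = g (phi x)) -> nondeg W -> stable phi W -> stable g W ->
    indec W ->
  (forall x, x \in W -> g x = 0 -> x = 0) \/
  (exists k, forall x, x \in W -> pow g k x = 0).
Proof.
move=> g_adj phig ndW phiW gW [_ Wind].
have [k [k_gt0 ndU phiU]] := fitting g_adj phig ndW phiW gW.
have [U0|U0] := eqVneq (W :&: lker (pow g k))%VS 0%VS.
  left=> x xW gx; apply/eqP; rewrite -memv0 -U0 memv_cap xW memv_ker.
  have g1 : pow g 1 x = 0 by rewrite powS pow0.
  by rewrite (pow_eq0 k_gt0 g1) eqxx.
right; exists k => x xW; have := Wind _ (capvSl _ _) ndU phiU U0.
by move/vspaceP/(_ x); rewrite xW memv_cap memv_ker => /andP[_ /eqP].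
Qed.

Lemma phi_pol_rho p x : phi (pol rho p x) = pol rho p (phi x).
Proof. by rewrite (pol_comm _ _ phi_rho). Qed.

Lemma annihilating_poly g x : exists2 p, p != 0 & pol g p x = 0.
Proof.
pose n := \dim {:V}.
pose h (c : 'rV[K]_n.+1) : V := \sum_i c 0 i *: pow g i x.
have h_lin : linear h.
  move=> a c d; rewrite /h scaler_sumr -big_split; apply: eq_bigr => i _.
  by rewrite !mxE scalerDl scalerA.
pose hL : {linear 'rV[K]_n.+1 -> V} :=
  HB.pack h (GRing.isLinear.Build _ _ _ _ h h_lin).
have ker0 : lker (linfun hL) != 0%VS.
  rewrite -dimv_eq0; have := limg_ker_dim (linfun hL) fullv.
  have := dimvS (subvf (limg (linfun hL))).
  have -> : \dim {:'rV[K]_n.+1} = n.+1 by rewrite dimvf dim_matrix mul1r.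
  rewrite capfv -/n => le_n dE; apply: contraTneq le_n => d0.
  by move: dE; rewrite d0 add0n => ->; rewrite ltnn.
have cker := memv_pick (lker (linfun hL)); set c := vpick _ in cker.
have c0 : c != 0 by rewrite vpick0.
exists (\poly_(i < n.+1) c 0 (inord i)).
  apply: contraNneq c0 => p0; apply/eqP/rowP => i; rewrite mxE.
  by have /polyP/(_ i) := p0; rewrite coef_poly ltn_ord inord_val coef0.
move: cker; rewrite memv_ker lfunE /= => /eqP <-.
rewrite (pol_widen g (size_poly _ _)) sum_lfunE; apply: eq_bigr => i _.
by rewrite scale_lfunE coef_poly ltn_ord inord_val.
Qed.

(** * Indecomposable pieces without fixed vectors *)

Section FixedPointFree.

Variable W : {vspace V}.
Hypotheses (ndW : nondeg W) (phiW : stable phi W) (indW : indec W).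
Hypothesis rho_inj : forall x, x \in W -> rho x = 0 -> x = 0.

Let rW p : stable (pol rho p) W.
Proof. exact/pol_stable/stable_rho. Qed.

Let inj_on p := forall x, x \in W -> pol rho p x = 0 -> x = 0.

(** By indecomposability such a [p] is nilpotent at [rho]: it is the prime whose power is the
    minimal polynomial of [rho] on [W]. *)
Let minimal_poly : exists p, [/\ p != 0, ~ inj_on p &
  forall q, q != 0 -> (size q < size p)%N -> inj_on q].
Proof.
have [p0 p0_neq0 ninj] : exists2 p, p != 0 & ~ inj_on p.
  have [p p0 px0] := annihilating_poly rho (vpick W).
  exists p => // /(_ _ (memv_pick W) px0) /eqP; rewrite vpick0.
  by have [/negPf->] := indW.
have [n] := ubnP (size p0); elim: n p0 p0_neq0 ninj => // n IHn p p0 ninj lt_n.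
have [[q [q0 lt_q ninjq]]|min] :=
  classic (exists q, [/\ q != 0, (size q < size p)%N & ~ inj_on q]).
  by apply: (IHn q) => //; apply: leq_trans lt_q lt_n.
exists p; split=> // q q0 lt_q; apply: NNPP => ninjq.
by apply: min; exists q.
Qed.

(* With [p] generating the ideal of polynomials nilpotent at [rho] and
   [p ^+ t.+1] vanishing on [W], a cyclic subspace [K[phi]u] is nondegenerate as
   soon as [B (p ^+ t (rho) (phi u)) u != 0], and such a [u] exists since the
   polarization of this quadratic map in [u] is the form
   [B (p ^+ t (rho) (rho x)) y]. *)
Lemma indec_free_cyc : exists2 u, u \in W & W = cyc phi u.
Proof.
have [p [p0 ninj pmin]] := minimal_poly.
have size_p : (1 < size p)%N.
  rewrite ltnNge; apply/negP => /size1_polyC pE; apply: ninj => x xW.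
  rewrite pE pol_polyC => /eqP; rewrite scaler_eq0 => /orP[/eqP p00|/eqP//].
  by case/eqP: p0; rewrite pE p00.
have [t ptW [x xW px]] : exists2 t, forall x, x \in W -> pol rho (p ^+ t.+1) x = 0 &
    exists2 x, x \in W & pol rho (p ^+ t) x != 0.
  have [//|[k pk]] := indec_nilp_or_inj (pol_adj p rho_adj) (phi_pol_rho p) ndW phiW
    (rW p) indW.
  have {pk} : forall x, x \in W -> pol rho (p ^+ k) x = 0.
    by move=> x xW; rewrite pol_exp pk.
  elim: k => [p1|k IHk pk].
    have [/eqP[]] := indW; apply/eqP; rewrite -vpick0 -(p1 _ (memv_pick W)).
    by rewrite pol_polyC scale1r.
  have [[x xW px]|none] := classic (exists2 x, x \in W & pol rho (p ^+ k) x != 0).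
    by exists k => //; exists x.
  by apply: IHk => x xW; apply/eqP/contraT => px; case: none; exists x.
have ptW' k y : (t < k)%N -> y \in W -> pol rho (p ^+ k) y = 0.
  by move=> /subnK<- yW; rewrite exprD pol_mul ptW ?linear0.
(* The remainder [r] of [q] is injective by minimality. On a vector killed by [q] it agrees with a
   multiple of [p], so [r^(t+1)] kills that vector. *)
have inj_ndvd q : ~~ (p %| q) -> inj_on q.
  rewrite /dvdp => qp y yW qy; pose r := q %% p.
  have r_inj : inj_on r by apply: pmin; rewrite // ltn_modp.
  have rE : pol rho r y = - pol rho (q %/ p * p) y.
    by move: qy; rewrite {1}(divp_eq q p) pol_add => /eqP; rewrite addrC addr_eq0 => /eqP.
  have ry k : pol rho (r ^+ k) y = pol rho ((q %/ p) ^+ k * p ^+ k) y.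
    elim: k => [|k IHk]; first by rewrite mulr1.
    rewrite exprSr pol_mul rE oppv2 -pol_mul mulrC pol_mul IHk -!pol_mul; congr (pol rho _ y).
    by rewrite !exprSr; ring.
  have : pol rho (r ^+ t.+1) y = 0 by rewrite ry pol_mul ptW ?linear0.
  elim: (t.+1) => [|k IHk]; first by rewrite pol_polyC scale1r.
  rewrite exprS pol_mul => /r_inj; rewrite (stableP _ _ (rW _)) // => /(_ isT).
  exact: IHk.
pose h a b := B (pol rho (p ^+ t) (phi a)) b.
have hD (a b c d : V) : h (a + b) (c + d) = h a c + h b c + (h a d + h b d).
  by rewrite /h !linearD /= qpolarDr !qpolarDl.
have [u uW hu] : exists2 u, u \in W & h u u != 0.
  have rpx : rho (pol rho (p ^+ t) x) != 0.
    by apply: contraNneq px => /rho_inj->; rewrite ?(stableP _ _ (rW _)).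
  have [|z zW] := nondeg_sep ndW _ rpx.
    by rewrite (stableP _ _ (stable_rho phiW)) ?(stableP _ _ (rW _)).
  have -> : B (rho (pol rho (p ^+ t) x)) z = h x z + h z x.
    rewrite rhoE qpolarDl phi_pol_rho psi_adj [h z x](pol_adj _ rho_adj).
    by rewrite [B (phi z) _]qpolarC.
  move=> hxz; have [hx|hx] := eqVneq (h x x) 0; last by exists x.
  have [hz|hz] := eqVneq (h z z) 0; last by exists z.
  exists (x + z); first exact: memvD.
  by rewrite hD hx hz add0r addr0 addrC.
pose M := cyc phi u; have uM : u \in M := cyc_gen _ _.
have phiM : stable phi M := stable_cyc _ _.
have sMW : (M <= W)%VS by apply: cyc_min.
pose Z := (M :&: perp M)%VS.
have sZW : (Z <= W)%VS := subv_trans (capvSl _ _) sMW.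
have phiZ : stable phi Z by apply: stable_perpI.
have rZ q : stable (pol rho q) Z by apply/pol_stable/stable_rho.
have top0 : pol rho (p ^+ t) u \notin Z.
  apply: contra hu => /memv_capP[_ /perpP pM].
  by rewrite /h -phi_pol_rho phi_adj pM // (stableP _ _ (stable_psi phiM)).
(* Split off the powers of [p]: the remaining factor is bijective on the radical [Z], so a nonzero
   vector of this form in [Z] would put [p^t (rho) u] into [Z], against [top0]. *)
have polZ0 q j : pol rho (p ^+ j * q) u \in Z -> pol rho (p ^+ j * q) u = 0.
  have [n] := ubnP (size q); elim: n q j => // n IHn q j lt_n.
  have [/dvdpP[r qE] | ndvd] := boolP (p %| q).
    rewrite {}qE in lt_n *; have [->|r0] := eqVneq r 0.
      by rewrite mul0r mulr0 pol_0.
    rewrite [r * p]mulrC mulrA -exprSr; apply: IHn.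
    move: lt_n; rewrite size_mul //.
    by move: (size r) (size p) size_p => a b; clear; lia.
  have [le_jt|lt_tj] := leqP j t; last by rewrite mulrC pol_mul ptW' ?linear0.
  move=> /(stableP _ _ (rZ (p ^+ (t - j)))); rewrite -pol_mul mulrA -exprD subnK // => ptq.
  case/negP: top0; have injZ : (Z :&: lker (pol rho q) = 0)%VS.
    apply/eqP; rewrite -subv0; apply/subvP => y /memv_capP[/(subvP sZW) yW].
    by rewrite memv_ker memv0 => /eqP /(inj_ndvd q ndvd y yW)->.
  have imZ : (pol rho q @: Z)%VS = Z.
    by apply/eqP; rewrite eqEdim [(_ <= _)%VS]rZ (limg_dim_eq injZ) leqnn.
  move: ptq; rewrite -{1}imZ mulrC pol_mul => /memv_imgP[z zZ /eqP].
  rewrite -subr_eq0 -linearB => /eqP /(inj_ndvd _ ndvd) /eqP.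
  rewrite subr_eq0 => /(_ _)/eqP->//.
  by rewrite memvB ?(subvP sZW _ zZ) ?(stableP _ _ (rW _)).
have polZ0' q : pol rho q u \in Z -> pol rho q u = 0.
  by have := polZ0 q 0%N; rewrite mul1r.
have decM z : z \in M -> exists a b, z = pol rho a u + phi (pol rho b u).
  have sub : (M <= cyc rho u + phi @: cyc rho u)%VS.
    apply: cyc_min; last by apply: subvP (addvSl _ _) _ (cyc_gen _ _).
    apply/stableP => _ /memv_addP[y yR [_ /memv_imgP[w wR ->] ->]].
    have -> : phi (y + phi w) = w + phi (y + rho w).
      rewrite rhoE !linearD /= psiK [X in _ = w + X]addrA [RHS]addrCA.
      by rewrite addvv2 addr0.
    rewrite memv_add ?memv_img // memvD //.
    by rewrite (stableP _ _ (stable_cyc _ _)).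
  move/(subvP sub)/memv_addP => [_ /cycP[a ->] [_ /memv_imgP[_ /cycP[b ->] ->] ->]].
  by exists a, b.
have ndM : nondeg M.
  apply/nondegP => z zM zp; have [a [b zE]] := decM z zM.
  have zZ : z \in Z by rewrite memv_cap zM.
  (* The radical is invariant under conjugation [phi^i u |-> phi^-i u]. The sum of [z] and its
     conjugate is [rho b(rho) u], to which [polZ0'] applies; then [b(rho) u = 0], and [z] itself
     lies in [K[rho] u]. *)
  have zbarZ : pol rho a u + psi (pol rho b u) \in Z.
    have psiM := stable_psi phiM.
    have rM q : pol rho q u \in M by rewrite (stableP _ _ (pol_stable q (stable_rho phiM))).
    have bar q k : B (pow phi k (pol rho q u)) u = B (pow psi k (pol rho q u)) u.
      rewrite (pow_adj _ psi_adj) (pol_adj _ rho_adj) qpolarC.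
      by rewrite (pow_comm _ _ (phi_pol_rho q)).
    rewrite memv_cap memvD ?(stableP _ _ psiM) //= memvE perp_sym.
    apply/span_subvP => _ /mapP[k _ ->]; apply/perpP => _ /vlineP[c ->].
    rewrite qpolarZr; apply/eqP; rewrite mulf_eq0; apply/orP; right; apply/eqP.
    have <- : B (pol rho a u + phi (pol rho b u)) (pow psi k u) = 0.
      by rewrite -zE (perpP _ _ zp) // (stableP _ _ (pow_stable k psiM)).
    rewrite qpolarC !qpolarDl -!(pow_adj k psi_adj) -!(pow_adj k phi_adj).
    by rewrite -!powSr !bar.
  have rb : pol rho ('X * b) u = 0.
    apply: polZ0'; rewrite pol_mul pol_X rhoE.
    by rewrite -[X in X \in _]add0r -(addvv2 (pol rho a u)) addrACA -zE memvD.
  have b0 : pol rho b u = 0.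
    by apply: rho_inj; rewrite ?(stableP _ _ (rW _)) // -pol_X -pol_mul.
  move: zE; rewrite b0 linear0 addr0 => zE; rewrite zE; apply: polZ0'.
  by rewrite -zE.
exists u => //; have [_ Wmax] := indW; rewrite -/M; apply/esym/Wmax => //.
apply: contraNneq hu => M0; move: uM; rewrite M0 memv0 => /eqP->.
by rewrite /h qpolar0r.
Qed.

End FixedPointFree.

(** * Unipotent pieces and the existence of factorizations *)

Definition unip_on W := exists k, forall x, x \in W -> pow N k x = 0.

Lemma unip_top W : unip_on W -> W != 0%VS -> exists t,
  (forall x, x \in W -> pow N t.+1 x = 0) /\ exists2 x, x \in W & pow N t x != 0.
Proof.
case=> k kW W0; elim: k kW => [|k IHk] kW.
  by case/eqP: W0; apply/eqP; rewrite -vpick0 -(pow0 N (vpick W)) kW ?memv_pick.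
have [[x xW x0]|none] := classic (exists2 x, x \in W & pow N k x != 0).
  by exists k; split=> //; exists x.
by apply: IHk => x xW; apply/eqP/contraT => x0; case: none; exists x.
Qed.

(** Nondegeneracy gives a vector [p(N) u] pairing with [N^t u]; only the constant term of [p]
    contributes, because the adjoint [N'] kills [N^t u]. *)
Lemma cyc_top u : nondeg (cyc phi u) -> unip_on (cyc phi u) -> cyc phi u != 0%VS ->
  exists2 t, pow N t.+1 u = 0 & B (pow N t u) u != 0.
Proof.
move=> ndU unipU U0; have [t [tU [x xU x0]]] := unip_top unipU U0.
have uN := tU u (cyc_gen _ _); exists t => //.
have Nu0 : pow N t u != 0.
  apply: contraNneq x0 => Nu0; move: xU; rewrite cyc_phiN => /cycP[p ->].
  by rewrite pow_pol Nu0 linear0.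
have NuU : pow N t u \in cyc phi u by rewrite cyc_phiN cyc_pow.
have [y] := nondeg_sep ndU NuU Nu0; rewrite cyc_phiN => /cycP[p ->].
rewrite -(pol_adj p N'_adj) pol_eq0 ?qpolarZl ?mulf_eq0 ?negb_or => [/andP[]//|].
by rewrite N'E -powS uN linear0.
Qed.

(** If the top form is not alternating, a vector with [B (N^t u) u] nonzero generates a
    nondegenerate cyclic subspace, which must be [W]; otherwise each two-generator construction
    fills [W]. The dimension [2 (t + 1)] is 0 or 2 modulo 4 according as [t] is odd or even. *)
Lemma indec_unip W : nondeg W -> stable phi W -> indec W -> unip_on W ->
  [\/ exists t u, [/\ pow N t.+1 u = 0, B (pow N t u) u != 0 & W = cyc phi u],
      exists t, [/\ odd t, \dim W = t.+1.*2 & split_parity W false]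
    | exists t, [/\ ~~ odd t, \dim W = t.+1.*2 & forall e, split_parity W e]].
Proof.
move=> ndW phiW [W0 Wmax] unipW; have [t [WN [x xW x0]]] := unip_top unipW W0.
have [[u uW uu]|alt] := classic (exists2 u, u \in W & B (pow N t u) u != 0).
  constructor 1; exists t, u; split; rewrite ?WN //; apply/esym/Wmax.
  - exact: cyc_min.
  - by apply: nondeg_cyc (WN u uW) uu.
  - exact: stable_cyc.
  apply: contraNneq uu => U0; have := cyc_gen phi u; rewrite U0 memv0 => /eqP->.
  by rewrite qpolar0r.
have {}alt y : y \in W -> B (pow N t y) y = 0.
  by move=> yW; apply/eqP/contraT => yy; case: alt; exists y.
have full U : [/\ (U <= W)%VS, nondeg U, stable phi U & \dim U = t.+1.*2] -> U = W.
  by case=> sUW ndU phiU dU; apply: Wmax; rewrite -?dimv_eq0 ?dU.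
have [t_odd|t_even] := boolP (odd t).
  constructor 2; exists t.
  have [U [sUW ndU phiU dU sU]] := split_parity_bicyc_even ndW phiW WN alt t_odd xW x0.
  by rewrite -(full U).
constructor 3; exists t.
have [u [uW u0 Qu]] := odd_gen ndW phiW t_even xW x0.
have [U [sUW ndU phiU dU sU]] :=
  split_parity_bicyc_odd ndW phiW WN alt t_even xW x0.
have [U' [sUW' ndU' phiU' dU' sU']] :=
  split_parity_bicyc_swap ndW phiW WN alt t_even uW u0 Qu.
have UW := full U (And4 sUW ndU phiU dU).
have UW' := full U' (And4 sUW' ndU' phiU' dU').
by rewrite -{1}UW; split=> // -[]; [rewrite -UW' | rewrite -UW].
Qed.

Lemma split_parity0 : split_parity 0 false.
Proof.
have sh g : shift g 0 = 0%N by rewrite /shift limg0 dimv0.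
exists \1%VF; split; rewrite ?sh //; split=> [x|x|x _|x]; rewrite ?id_lfunE //.
by rewrite memv0 => /eqP->; rewrite !linear0.
Qed.

Lemma not_indec W : W != 0%VS -> ~ indec W -> exists U,
  [/\ (U <= W)%VS, nondeg U, stable phi U & (0 < \dim U < \dim W)%N].
Proof.
move=> W0 nind; apply: NNPP => none; case: nind; split=> // U sUW ndU phiU U0.
apply/eqP/contraT => UW; case: none; exists U; split=> //.
by rewrite lt0n dimv_eq0 U0 (ltn_leqif (dimv_leqif_eq sUW)).
Qed.

Theorem split_parity_exists W : nondeg W -> stable phi W ->
  split_parity W (odd (\dim W)./2).
Proof.
have [n] := ubnP (\dim W); elim: n W => // n IHn W lt_n ndW phiW.
have [->|W0] := eqVneq W 0%VS; first by rewrite dimv0; apply: split_parity0.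
have [indW|/(not_indec W0)[U [sUW ndU phiU dU]]] := classic (indec W); last first.
  have ndU' := nondeg_compl ndW sUW ndU.
  have phiU' : stable phi (W :&: perp U) by apply: stable_perpI.
  have dW := dim_perp_in ndW sUW.
  have parW : odd (\dim W)./2 = odd (\dim U)./2 (+) odd (\dim (W :&: perp U))./2.
    have := even_dim_nd ndU; have := even_dim_nd ndU'; rewrite -dW.
    by move: (\dim U) (\dim (_ :&: _)) => a b; clear; lia.
  rewrite parW -{1}(nondeg_add ndW sUW ndU); apply: split_parityD => //.
  - by rewrite perp_sym capvSr.
  - apply: IHn => //; move: dU lt_n; move: (\dim U) (\dim W) => a b.
    by clear; lia.
  apply: IHn => //; move: dU lt_n dW.
  by move: (\dim U) (\dim W) (\dim _) => a b c; clear; lia.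
have [inj|[k rk]] := indec_nilp_or_inj rho_adj (fun x => esym (phi_rho x)) ndW phiW
  (stable_rho phiW) indW.
  have [u uW WE] := indec_free_cyc ndW phiW indW inj.
  have genu : generates (fun=> u : V) W (J := unit).
    by split=> // U phiU /(_ tt) uU; rewrite WE cyc_min.
  have [//|a b k|s [sQ sp sphi sg]] := inverter_exists ndW phiW genu genu.
    by rewrite qpolarC.
  have sW := inverts_intro ndW phiW genu sQ sp sphi sg sg.
  have kerN : (W :&: lker N = 0)%VS.
    apply/eqP; rewrite -subv0; apply/subvP => x /memv_capP[xW].
    rewrite memv_ker => /eqP Nx; rewrite memv0; apply/eqP/inj => //.
    by rewrite rhoN Nx !linear0.
  have sW' := inverts_stable sW; case: (sW) => _ sK _ spp.
  have [a_half ev] := parity_free ndW phiW sW' sQ sK spp kerN.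
  by exists s; split; rewrite // -a_half doubleK.
have unipW : unip_on W.
  exists k.*2 => x xW; apply/eqP; rewrite -(pow_psi_eq0 k) -pow_rho.
  exact/eqP/rk.
have [[t [u [uN uu ->]]]|[t [t_odd -> sp]]|[t [_ _ //]]] :=
  indec_unip ndW phiW indW unipW.
  exact: split_parity_cyc uN uu.
by rewrite doubleK /= t_odd.
Qed.

(** * Parity of arbitrary inverting involutions *)

(* No Jordan block of odd size, and the top form of the blocks of each even
   size is alternating. *)
Definition alternating_blocks W := forall t u v, u \in W -> v \in W ->
    pow N t.+1 u = 0 -> pow N t.+1 v = 0 ->
  B (pow N t u) u = 0 /\ (~~ odd t -> B (pow N t u) v = 0).

(** Conditions (a) and (b) of the theorem, read on the subspace instead of on the restriction. *)
Definition good_summand U := [/\ U != 0%VS, nondeg U, stable phi U, unip_on U &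
  (exists u, U = cyc phi u) \/ (indec U /\ (\dim U = 2 %[mod 4])%N)].

Lemma alternating_blocksD U W : stable phi U -> stable phi W ->
    (U <= perp W)%VS -> (U :&: W = 0)%VS ->
  alternating_blocks U -> alternating_blocks W -> alternating_blocks (U + W).
Proof.
move=> /stable_N NU /stable_N NW oUW UW0 altU altW t x y.
have sU k := stableP _ _ (pow_stable k NU); have sW k := stableP _ _ (pow_stable k NW).
have split0 k u w : u \in U -> w \in W -> pow N k (u + w) = 0 ->
    pow N k u = 0 /\ pow N k w = 0.
  move=> uU wW; rewrite linearD /= => /eqP; rewrite eq_add2 => /eqP e.
  suff u0 : pow N k u = 0 by rewrite -e u0.
  by apply/eqP; rewrite -memv0 -UW0 memv_cap sU // e sW.
have orth u w : u \in U -> w \in W -> B u w = 0.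
  by move=> uU; apply/perpP/(subvP oUW).
case/memv_addP => u uU [w wW ->] /memv_addP[u' uU' [w' wW' ->]].
move=> xN yN; have [uN wN] := split0 _ u w uU wW xN.
have [uN' wN'] := split0 _ u' w' uU' wW' yN.
have [uu uu'] := altU t u u' uU uU' uN uN'.
have [ww ww'] := altW t w w' wW wW' wN wN'.
have orth' a b : a \in U -> b \in W -> B (pow N t b) a = 0.
  by move=> aU bW; rewrite qpolarC orth ?sW.
rewrite linearD /= !(qpolarDl, qpolarDr) uu ww (orth _ w) ?sU // (orth _ w') ?sU //.
rewrite (orth' u w) // (orth' u' w) // !(addr0, add0r); split=> // t_even.
by rewrite uu' ?ww' ?addr0.
Qed.

(** On an indecomposable [W], a nonzero [B (N^t x) x] makes [W] cyclic, and a nonzero [B (N^t u) v]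
    with [t] even makes [\dim W = 2 (t + 1)], which is 2 modulo 4; either way [W] is good. *)
Lemma alternating_or_good W : nondeg W -> stable phi W -> unip_on W ->
  alternating_blocks W \/ exists2 U, (U <= W)%VS & good_summand U.
Proof.
have [n] := ubnP (\dim W); elim: n W => // n IHn W lt_n ndW phiW unipW.
have [->|W0] := eqVneq W 0%VS.
  left=> t u v; rewrite !memv0 => /eqP-> /eqP-> _ _.
  by rewrite !linear0 qpolar0l.
have sub U : (U <= W)%VS -> unip_on U.
  by move=> /subvP sUW; case: unipW => k kW; exists k => x /sUW/kW.
have [indW|/(not_indec W0)[U [sUW ndU phiU dU]]] := classic (indec W); last first.
  have ndU' := nondeg_compl ndW sUW ndU.
  have phiU' : stable phi (W :&: perp U) by apply: stable_perpI.
  have dW := dim_perp_in ndW sUW.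
  have [|altU|[X sXU goodX]] := IHn U _ ndU phiU (sub U sUW).
  - move: dU lt_n; move: (\dim U) (\dim W) => a b; clear; lia.
  - have [|altU'|[X sXU goodX]] := IHn _ _ ndU' phiU' (sub _ (capvSl _ _)).
    + move: dU lt_n dW; move: (\dim U) (\dim W) (\dim _) => a b c; clear; lia.
    + left; rewrite -(nondeg_add ndW sUW ndU).
      have oU : (U <= perp (W :&: perp U))%VS by rewrite perp_sym capvSr.
      apply: alternating_blocksD => //; apply/eqP; rewrite -subv0 -(eqP ndU).
      by rewrite capvS ?capvSr.
    by right; exists X => //; apply: subv_trans sXU (capvSl _ _).
  by right; exists X => //; apply: subv_trans sXU sUW.
have [good|ngood] := classic (good_summand W); first by right; exists W.
left=> t u v uW vW uN vN; have [_ Wmax] := indW.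
have alt x : x \in W -> pow N t.+1 x = 0 -> B (pow N t x) x = 0.
  move=> xW xN; apply/eqP/contraT => xx; case: ngood.
  split=> //; left; exists x; apply/esym/Wmax; first exact: cyc_min.
  - exact: nondeg_cyc xN xx.
  - exact: stable_cyc.
  apply: contraNneq xx => U0; have := cyc_gen phi x; rewrite U0 memv0 => /eqP->.
  by rewrite qpolar0r.
split=> [|t_even]; first exact: alt.
apply/eqP/contraT => uv; case: ngood; split=> //; right; split=> //.
have ndU := nondeg_bicyc uN vN uv (alt u uW uN) (alt v vW vN).
have dU := dim_bicyc uN vN uv (alt u uW uN) (alt v vW vN).
rewrite -(Wmax _ _ ndU (stable_bicyc u v)) ?subv_add ?cyc_min // -?dimv_eq0 dU //.
by move: t_even; clear; lia.
Qed.

(** With [d = s - 1] and [X] the preimage of [L] in [W], [B x (d x) = Q (d x) = 0] on [X] because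
    [L] is totally singular. The radical [R] of this alternating form on [X] contains the kernel of
    [d] and has [d R = d L], so the even rank of the form is [shift s W] minus twice the dimension
    of [d L]. *)
Lemma lagrangian_even s W L : isom s -> (forall x, s (s x) = x) -> nondeg W ->
    stable s W -> (L <= W)%VS -> stable s L -> (forall x, x \in L -> Q x = 0) ->
    (W :&: perp L <= L)%VS ->
  ~~ odd (shift s W).
Proof.
move=> sQ sK ndW sW sLW sL LQ Lmax; set d := (s - \1)%VF.
have d_adj x z : B (d x) z = B x (d z).
  by rewrite !shiftE qpolarDl qpolarDr -{1}(sK z) isomB.
have dS U : stable s U -> stable d U.
  by move=> sU; apply/stableP => x xU; rewrite shiftE memvD // (stableP _ _ sU).
have oL : (L <= W :&: perp L)%VS.
  rewrite subv_cap sLW; apply/subvP => x xL; apply/perpP => y yL.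
  have := quadD x y; rewrite !LQ ?memvD //; by rewrite !add0r => <-.
have LE : (W :&: perp L = L)%VS by apply/eqP; rewrite eqEsubv Lmax.
set X := (W :&: d @^-1: L)%VS.
have XE : X = (W :&: perp (d @: L))%VS.
  apply/vspaceP => x; rewrite !memv_cap -memv_preim.
  apply/andP/andP => -[xW xL]; split=> //.
    apply/perpP => _ /memv_imgP[l lL ->]; rewrite -d_adj.
    by have /memv_capP[_ /perpP] := subvP oL _ xL; apply.
  rewrite -LE memv_cap (stableP _ _ (dS W sW)) //; apply/perpP => l lL.
  by rewrite d_adj (perpP _ _ xL) ?memv_img.
have dLW : (d @: L <= W)%VS := subv_trans (dS L sL) sLW.
have dX := dim_perp_in ndW dLW; rewrite -XE in dX.
have perpX : (W :&: perp X = d @: L)%VS by rewrite XE perp_perp_in.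
have sXW : (X <= W)%VS := capvSl _ _.
have altX x : x \in X -> B x (d x) = 0.
  rewrite memv_cap -memv_preim => /andP[_ /LQ]; rewrite !shiftE quadD sQ.
  by rewrite addrr_pchar2 // add0r qpolarDr qpolarxx addr0 qpolarC.
have := even_alternating altX; set R := (X :&: d @^-1: perp X)%VS.
have dimX := limg_ker_dim d X; have dimR := limg_ker_dim d R.
have dimW := limg_ker_dim d W.
have kerX : (X :&: lker d = W :&: lker d)%VS.
  apply/vspaceP => x; rewrite !memv_cap -memv_preim memv_ker.
  by case: eqP => [->|]; rewrite ?mem0v ?andbT ?andbF.
have kerR : (R :&: lker d = W :&: lker d)%VS.
  rewrite -kerX; apply/vspaceP => x; rewrite !memv_cap -!memv_preim memv_ker.
  by case: eqP => [->|]; rewrite ?mem0v ?andbT ?andbF.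
have imR : (d @: R = d @: L)%VS.
  apply/eqP; rewrite eqEsubv; apply/andP; split.
    apply/subvP => z /memv_imgP[x /memv_capP[xX]]; rewrite -memv_preim => xp ->.
    rewrite -perpX memv_cap xp (stableP _ _ (dS W sW)) //.
    exact: subvP sXW _ xX.
  apply: limgS; apply/subvP => l lL; rewrite !memv_cap -!memv_preim.
  have dl := stableP _ _ (dS L sL) _ lL; rewrite (subvP sLW) // dl /=.
  have : d l \in (W :&: perp X)%VS by rewrite perpX memv_img.
  by case/memv_capP.
have sRX : (\dim R <= \dim X)%N by rewrite dimvS ?capvSl.
move: dimX dimR dimW sRX dX; rewrite kerX kerR imR -/(shift s W).
move: (\dim R) (\dim X) (\dim W) (shift s W) (\dim (d @: L)) (\dim (W :&: lker d))
  (\dim (d @: X)) => r x w a l k j; clear; lia.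
Qed.

Lemma pow_N'_eq0 k x : (pow N' k x == 0) = (pow N k x == 0).
Proof. by rewrite pow_N' pow_psi_eq0. Qed.

Lemma perp_ker_pow W k : nondeg W -> stable phi W ->
  (W :&: perp (W :&: lker (pow N k)) = pow N k @: W)%VS.
Proof.
move=> ndW phiW; have NW := pow_stable k (stable_N phiW).
apply/eqP; rewrite eq_sym eqEdim; apply/andP; split.
  rewrite subv_cap [X in X && _]NW; apply/subvP => _ /memv_imgP[x xW ->].
  apply/perpP => z /memv_capP[_]; rewrite memv_ker -pow_N'_eq0 => /eqP gz.
  by rewrite (pow_adj _ N_adj) gz qpolar0r.
have := dim_perp_in ndW (capvSl W (lker (pow N k))).
have := limg_ker_dim (pow N k) W.
move: (\dim _) (\dim _) (\dim _) (\dim _) => a b c d; clear; lia.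
Qed.

(** * The invariant Lagrangian subspace *)

Section AlternatingBlocks.

Variables (W : {vspace V}) (n : nat).
Hypotheses (ndW : nondeg W) (phiW : stable phi W).
Hypothesis WN : forall x, x \in W -> pow N n x = 0.
Hypothesis altW : alternating_blocks W.

Let NW k : stable (pow N k) W.
Proof. exact/pow_stable/stable_N. Qed.

Let middle i : {vspace V} := (pow N i @: (W :&: lker (pow N i.*2)))%VS.

(* A totally singular Lagrangian subspace of [W]: it contains the middle layer
   of each Jordan block, and is invariant under all maps inverting [phi]. *)
Let L : {vspace V} := (\sum_(i < n.+1) middle i)%VS.

Let middleP i a : a \in W -> pow N i.*2 a = 0 -> (i <= n)%N -> pow N i a \in L.
Proof.
move=> aW aN le_in; have lt_in : (i < n.+1)%N by [].
have /subvP : (middle i <= L)%VS by apply: (sumv_sup (Ordinal lt_in)).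
apply; by rewrite memv_img // memv_cap aW memv_ker aN /=.
Qed.

Let L_ind (P : V -> Prop) : P 0 -> (forall x y, P x -> P y -> P (x + y)) ->
    (forall i a, a \in W -> pow N i.*2 a = 0 -> (i <= n)%N -> P (pow N i a)) ->
  forall x, x \in L -> P x.
Proof.
move=> P0 PD Pm x /memv_sumP[z zm ->]; elim/big_ind: _ => // i _.
have /memv_imgP[a /memv_capP[aW]] := zm i isT.
by rewrite memv_ker => /eqP aN ->; apply: Pm => //; rewrite -ltnS.
Qed.

Let L_sub : (L <= W)%VS.
Proof.
apply/subvP; apply: L_ind => [|x y|i a aW _ _]; rewrite ?mem0v //.
  exact: memvD.
exact: stableP (NW i) a aW.
Qed.

Let L_stable g : (forall i a, a \in W -> pow N i.*2 a = 0 -> (i <= n)%N ->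
   g (pow N i a) \in L) -> stable g L.
Proof.
move=> gm; apply/stableP; apply: L_ind => [|x y|//]; rewrite ?linear0 ?mem0v //.
by rewrite linearD; apply: memvD.
Qed.

Let L_phi : stable phi L.
Proof.
have phiN' k z : pow N k (phi z) = phi (pow N k z).
  by apply: pow_comm => y; rewrite phiN.
apply: L_stable => i a aW aN le_in; rewrite -phiN' middleP //.
  exact: stableP phiW a aW.
by rewrite phiN' aN linear0.
Qed.

Let L_anti s : stable s W -> (forall x, x \in W -> s (phi x) = psi (s x)) ->
  stable s L.
Proof.
move=> sW sphi; apply: L_stable => i a aW aN le_in.
rewrite (anti_pow_N i phiW sphi) // pow_N'.
rewrite (stableP _ _ (pow_stable _ (stable_psi L_phi))) // middleP //.
  exact: stableP sW a aW.
by apply/eqP; rewrite -pow_N'_eq0 -(anti_pow_N _ phiW sphi) // aN linear0.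
Qed.

(** For [j <= i], moving [N^i] across gives [N^(i+j) b] up to a power of [psi], and
    [i + j >= 2 j]. *)
Let L_isotropic : (L <= perp L)%VS.
Proof.
have main i j a b : (j <= i)%N -> pow N j.*2 b = 0 -> B (pow N i a) (pow N j b) = 0.
  move=> le_ji bN; rewrite (pow_adj _ N_adj) pow_N' -powD.
  by rewrite (pow_eq0 _ bN) ?linear0 ?qpolar0r // -addnn leq_add2r.
apply/subvP; apply: L_ind => [|x y|i a aW aN le_in]; rewrite ?mem0v //.
  exact: memvD.
apply/perpP; apply: L_ind => [|x y xa ya|j b bW bN le_jn]; first exact: qpolar0r.
  by rewrite qpolarDr xa ya addr0.
by have [/main->|/ltnW/main le] := leqP j i; rewrite // qpolarC le.
Qed.

(** Isotropy reduces to generators, where [quad_powN] turns [Q (N^(k+1) a)] into the top form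
    [B (N^(2k+1) a) a], zero by the first clause of [alternating_blocks]. *)
Let L_singular x : x \in L -> Q x = 0.
Proof.
move=> xL; suff [] : x \in L /\ Q x = 0 by [].
apply: (L_ind (P := fun x => x \in L /\ Q x = 0)) xL => [|y z [yL y0] [zL z0]|].
- by rewrite mem0v quad0.
- by rewrite memvD // quadD y0 z0 !add0r (perpP _ _ (subvP L_isotropic _ yL)).
move=> i a aW aN le_in; rewrite middleP //; split=> //.
case: i aN le_in => [|k] aN _; first by move: aN; rewrite !pow0 => ->; rewrite quad0.
rewrite quad_powN -[phi _](addvK2 (pow rho k a)) [pow rho k a + phi _]addrC -shiftE.
rewrite qpolarDl rho_alt add0r N_rho_pow pow_fix ?(altW aW aW _ _).1 //.
by apply: psi_fix; apply: N_top.
Qed.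

(** Let [y = N^t x] have height [h]: [y = N^h z], but [y] is not in [N^(h+1) W]. Then some [w]
    killed by [N^(h+1)] pairs with [y], so [h] is odd by the second clause of [alternating_blocks].
    Orthogonality of [x] to [L] forces [t < (h + 1) / 2], so [N^(h-t) z] lies in [L]; subtracting it
    from [x] lowers [t]. *)
Let L_maximal x t : x \in W -> x \in perp L -> pow N t x = 0 -> x \in L.
Proof.
elim: t x => [|t IHt] x xW xp xN; first by move: xN; rewrite pow0 => ->; apply: mem0v.
have [y0|y0] := eqVneq (pow N t x) 0; first exact: IHt.
set y := pow N t x in y0; have Ny : N y = 0 by rewrite /y -powS.
have [h [le_th lt_hn yh yh1]] : exists h : nat, [/\ (t <= h)%N, (h < n)%N,
    y \in (pow N h @: W)%VS & y \notin (pow N h.+1 @: W)%VS].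
  have yn : y \notin (pow N n @: W)%VS.
    by apply: contra y0 => /memv_imgP[z /WN-> ->].
  have yt : y \in (pow N t @: W)%VS by apply: memv_img.
  have: forall k, (t <= k)%N -> y \in (pow N k @: W)%VS -> exists h : nat,
      [/\ (t <= h)%N, (h < n)%N, y \in (pow N h @: W)%VS & y \notin (pow N h.+1 @: W)%VS].
    move=> k; have [j] := ubnP (n - k); elim: j k => // j IHj k lt_j le_tk yk.
    have lt_kn : (k < n)%N.
      rewrite ltnNge; apply/negP => le_nk; case/negP: yn; apply: subvP yk.
      by rewrite -(subnKC le_nk); apply/subvP => _ /memv_imgP[z zW ->];
         rewrite powD memv_img // (stableP _ _ (NW _)).
    have [yk1|nyk1] := boolP (y \in (pow N k.+1 @: W)%VS); last by exists k.
    apply: (IHj k.+1) => //; last exact: leqW.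
    by move: lt_j lt_kn; clear; lia.
  by apply; last exact: yt.
have /memv_imgP[z zW yE] := yh.
have zN : pow N h.+1 z = 0 by rewrite powS -yE.
have [w [wW wN yw]] : exists w, [/\ w \in W, pow N h.+1 w = 0 & B y w != 0].
  have yW : y \in W := stableP _ _ (NW t) _ xW.
  move: yh1; rewrite -perp_ker_pow // memv_cap yW /=.
  case/mem_orthovPn => w /memv_capP[wW]; rewrite memv_ker => /eqP wN yw.
  by exists w.
have h_odd : odd h.
  apply: contraNT yw => h_even; rewrite yE.
  by rewrite (altW zW wW zN wN).2.
pose i := h.+1./2; have iE : i.*2 = h.+1 by rewrite even_halfK //= h_odd.
have le_in : (i <= n)%N by move: iE lt_hn; clear; lia.
have midL a : a \in W -> pow N h.+1 a = 0 -> pow N i a \in L.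
  by move=> aW aN; apply: middleP; rewrite ?iE.
have NL k a : a \in L -> pow N k a \in L.
  exact: stableP (pow_stable k (stable_N L_phi)) a.
have lt_ti : (t < i)%N.
  rewrite ltnNge; apply: contra yw => le_it.
  rewrite /y (pow_adj _ N_adj) pow_N' (perpP _ _ xp) //.
  rewrite (stableP _ _ (pow_stable _ (stable_psi L_phi))) //.
  by rewrite -(subnK le_it) powD NL ?midL.
pose x' := pow N (h - t) z; have x'L : x' \in L.
  have le : (i <= h - t)%N by move: lt_ti iE le_th; clear; lia.
  by rewrite /x' -(subnK le) powD NL ?midL.
rewrite -(subrK x' x) memvD //; apply: IHt.
- by rewrite memvB // (subvP L_sub).
- by rewrite memvB // (subvP L_isotropic).
by rewrite linearB /= -powD subnKC // -yE subrr.
Qed.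

Lemma alternating_even s : isom s -> (forall x, s (s x) = x) -> stable s W ->
  (forall x, x \in W -> s (phi x) = psi (s x)) -> ~~ odd (shift s W).
Proof.
move=> sQ sK sW sphi.
apply: (lagrangian_even sQ sK ndW sW L_sub (L_anti sW sphi) L_singular).
by apply/subvP => x /memv_capP[xW xp]; apply: (L_maximal (t := n)) => //; apply: WN.
Qed.

End AlternatingBlocks.

(** * Bireflectional isometries *)

Local Notation SO := (special_orthogonal_group Q).

Lemma stable_full g : stable g {:V}.
Proof. exact: subvf. Qed.

Lemma SO_intro g : isom g -> ~~ odd (shift g {:V}) -> SO g.
Proof. by move=> gQ g_even; split=> //; split=> //; apply: isom_lker0. Qed.

(** The clause on the three shifts makes [shift] even for [s \o phi] as soon as it is for [s] and
    [phi]. *)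
Lemma bireflectional_of_parity : ~~ odd (shift phi {:V}) ->
  split_parity {:V} false -> bireflectional_in SO phi.
Proof.
move=> phi_even [s [[sQ sK _ spp] s_even ev]]; exists s, (s \o phi)%VF; split.
- by apply: SO_intro; rewrite // s_even.
- by apply/lfunP => x; rewrite comp_lfunE sK id_lfunE.
- apply: SO_intro => [x|]; first by rewrite comp_lfunE sQ phiQ.
  by move: ev; rewrite !oddD s_even (negPf phi_even) addbF.
- by apply/lfunP => x; rewrite !comp_lfunE spp ?memvf ?id_lfunE.
by apply/lfunP => x; rewrite !comp_lfunE sK.
Qed.

Lemma bireflectional_inverts : bireflectional_in SO phi -> exists s,
  [/\ isom s, forall x, s (s x) = x, ~~ odd (shift s {:V}),
      forall x, s (phi x) = psi (s x) & forall x, s (phi (s (phi x))) = x].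
Proof.
case=> s [t [[[_ sQ] s_even] /lfunP ss _ /lfunP tt' phiE]].
have sK x : s (s x) = x by have := ss x; rewrite comp_lfunE id_lfunE.
have tK x : t (t x) = x by have := tt' x; rewrite comp_lfunE id_lfunE.
have spp x : s (phi (s (phi x))) = x by rewrite phiE !comp_lfunE !sK tK.
by exists s; split=> // x; rewrite -[s (phi x)]phiK -{2}(spp x) sK.
Qed.

Lemma not_bireflectional : (lker N = 0)%VS -> bireflectional_in SO phi ->
  (\dim {:V} = 0 %[mod 4])%N.
Proof.
move=> kerN /bireflectional_inverts[s [sQ sK s_even _ spp]].
have [|half _] := parity_free ndV (stable_full phi) (stable_full s) sQ sK
  (fun x _ => spp x); first by rewrite capfv.
by rewrite -half -muln2 -[LHS]modnMml; move: s_even; move: (shift s _) => a; clear; lia.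
Qed.

(** [V1] is the generalized eigenspace of [phi] for 1. Without a good summand, [s] has even shift on
    [V1] and [\dim V1] is 0 modulo 4; on [perp V1] the shift is half the dimension and must be even,
    so [\dim {:V}] would be 0 modulo 4. *)
Lemma bireflectional_good : (\dim {:V} = 2 %[mod 4])%N -> bireflectional_in SO phi ->
  exists U, good_summand U.
Proof.
move=> dV /bireflectional_inverts[s [sQ sK s_even sphi spp]].
have [k [k_gt0]] := fitting rho_adj (fun x => esym (phi_rho x)) ndV (stable_full phi)
  (stable_full rho).
rewrite capfv; set V1 := lker (pow rho k) => nd1 phi1.
have V1P x : (x \in V1) = (pow N k.*2 x == 0).
  by rewrite memv_ker pow_rho pow_psi_eq0.
have V1N x : x \in V1 -> pow N k.*2 x = 0 by rewrite V1P => /eqP.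
have unip1 : unip_on V1 by exists k.*2.
have [alt1|[U _ goodU]] := alternating_or_good nd1 phi1 unip1; last by exists U.
have s1 : stable s V1.
  apply/stableP => x; rewrite V1P => /eqP xN; rewrite V1P -pow_N'_eq0.
  by rewrite -(anti_pow_N _ (stable_full phi)) ?memvf // xN linear0.
have s_even1 : ~~ odd (shift s V1).
  by apply: (alternating_even nd1 phi1 V1N alt1).
(* Some inverting involution has the parity of half of [\dim V1], while [alternating_even] makes
   every one of them even. *)
have dim1 : ~~ odd (\dim V1)./2.
  have [s' [sV' s_odd' _]] := split_parity_exists nd1 phi1.
  rewrite -s_odd'; have sphi' := inverts_phi sV'; have sW' := inverts_stable sV'.
  by case: (sV') => sQ' sK' _ _; apply: (alternating_even nd1 phi1 V1N alt1).
have nd2 := nondeg_perp nd1.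
have phi2 : stable phi (perp V1) := stable_perp phiQ phi1.
have s2 : stable s (perp V1) := stable_perp sQ s1.
have ker2 : (perp V1 :&: lker N = 0)%VS.
  apply/eqP; rewrite -subv0 -(eqP nd1) capvC capvS ?subvv //; apply/subvP => x.
  rewrite memv_ker V1P => /eqP Nx.
  have N1 : pow N 1 x = 0 by rewrite powS pow0.
  by rewrite (pow_eq0 _ N1) // double_gt0.
have [half _] := parity_free nd2 phi2 s2 sQ sK (fun x _ => spp x) ker2.
have shV : shift s {:V} = (shift s V1 + shift s (perp V1))%N.
  by rewrite -(addv_perp nd1) shiftD //; apply/eqP.
have dVE := dim_perp V1; have even1 := even_dim_nd nd1.
exfalso; move: dV s_even s_even1 dim1 half shV dVE even1.
move: (\dim {:V}) (\dim V1) (\dim (perp V1)) (shift s {:V}) (shift s V1)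
  (shift s (perp V1)) => a b c d e f; clear; lia.
Qed.

Lemma good_split_parity U e : good_summand U -> split_parity U e.
Proof.
case=> U0 ndU phiU unipU [[u UE]|[indU dU]].
  rewrite UE in ndU unipU U0 *.
  by have [t uN uu] := cyc_top ndU unipU U0; apply: split_parity_cyc uN uu.
have [[t [u [uN uu ->]]]|[t [t_odd dUE _]]|[t [_ _ sp]]] :=
  indec_unip ndU phiU indU unipU.
- exact: split_parity_cyc uN uu.
- by exfalso; move: t_odd dU; rewrite dUE; clear; lia.
exact: sp.
Qed.

(** Either parity is available on [U], so it is chosen to cancel the one obtained on [perp U]. *)
Lemma good_bireflectional U : ~~ odd (shift phi {:V}) -> good_summand U ->
  bireflectional_in SO phi.
Proof.
move=> phi_even goodU; apply: bireflectional_of_parity => //.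
have [_ ndU phiU _ _] := goodU; have ndU' := nondeg_perp ndU.
have phiU' : stable phi (perp U) := stable_perp phiQ phiU.
rewrite -(addv_perp ndU) -(addbb (odd (\dim (perp U))./2)).
apply: split_parityD => //; first by rewrite perp_sym.
  exact: good_split_parity.
exact: split_parity_exists.
Qed.

End Orthogonal.

(** * Translation between stable subspaces and restricted quadratic spaces *)

Section NondefectiveSubspace.

Variables (K : fieldType) (V : vectType K) (Q : quadform V).


Lemma nondefectiveE (V' : vectType K) (Q' : quadform V') :
  nondefective Q' = nondeg Q' {:V'}.
Proof. by rewrite /nondeg capfv. Qed.

Lemma res_qpolar W (u v : subvs_of W) :
  qpolar (res_quadform Q W) u v = qpolar Q (vsval u) (vsval v).
Proof. by []. Qed.

Lemma nondefective_subspaceE W : nondefective_subspace Q W = nondeg Q W.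
Proof.
rewrite /nondefective_subspace nondefectiveE.
apply/nondegP/nondegP => [nondeg0 x xW /perpP xp|nondeg0 x _ /perpP xp].
  rewrite -(vsprojK xW) (nondeg0 (vsproj W x)) ?memvf ?linear0 //.
  by apply/perpP => y _; rewrite res_qpolar vsprojK // xp ?subvsP.
apply: subvs_inj; rewrite linear0; apply: nondeg0; first exact: subvsP.
by apply/perpP => y yW; rewrite -(vsprojK yW) -res_qpolar xp ?memvf.
Qed.

Lemma orthogonal_summandE phi W : orthogonal_summand Q phi W <->
  [/\ W != 0%VS, nondeg Q W & stable phi W].
Proof. by rewrite /orthogonal_summand nondefective_subspaceE; split. Qed.

End NondefectiveSubspace.

Section Restriction.

Variables (K : fieldType) (V : vectType K) (Q : quadform V) (phi : 'End(V)).

Local Notation N g := (g - \1)%VF.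


Section StableSubspace.

Variable W : {vspace V}.
Hypothesis phiW : stable phi W.

Let incl := linfun (@vsval K V W).

Lemma res_lfunE (u : subvs_of W) : vsval (res_lfun phi W u) = phi (vsval u).
Proof.
by rewrite /res_lfun !comp_lfunE !lfunE /= vsprojK // (stableP _ _ phiW) ?subvsP.
Qed.

Lemma unipotent_resE : unipotent (res_lfun phi W) <-> unip_on phi W.
Proof.
have iterE n u : vsval (iter n (N (res_lfun phi W)) u) = pow (N phi) n (vsval u).
  elim: n => [|n IHn]; first by rewrite pow0.
  rewrite powS -IHn /= !add_lfunE !opp_lfunE !id_lfunE linearB /=.
  by rewrite res_lfunE.
split=> -[n nW]; exists n; [move=> x xW | move=> u].
  by rewrite -(vsprojK xW) -iterE nW linear0.
by apply: subvs_inj; rewrite iterE nW ?subvsP // linear0.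
Qed.

Lemma cyclic_resE :
  cyclic_transformation (res_lfun phi W) <-> exists v, W = cyc phi v.
Proof.
have iterE n u : vsval (iter n (res_lfun phi W) u) = pow phi n (vsval u).
  by elim: n => [|n IHn]; rewrite ?pow0 // powS -IHn /= res_lfunE.
split=> [[v vW]|[v WE]].
  exists (vsval v); apply/eqP; rewrite eqEsubv cyc_min ?subvsP // andbT.
  apply/subvP => x xW; have [n xn] := vW (vsproj W x).
  have : x \in (incl @: <<[seq iter i (res_lfun phi W) v | i <- iota 0 n]>>)%VS.
    by rewrite -(vsprojK xW); apply/memv_imgP; exists (vsproj W x); rewrite ?lfunE.
  rewrite limg_span; apply/subvP/span_subvP => _ /mapP[_ /mapP[i _ ->] ->].
  by rewrite lfunE /= iterE cyc_pow.
have vW : v \in W by rewrite WE cyc_gen.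
exists (vsproj W v) => u; exists (\dim {:V}).
have uW : vsval u \in cyc phi v by rewrite -WE subvsP.
rewrite -(vsvalK u) -[vsproj W _](lfunE (vsproj W)).
have := memv_img (linfun (vsproj W)) uW; rewrite limg_span -map_comp.
rewrite (eq_map (g := fun i => iter i (res_lfun phi W) (vsproj W v))) // => i /=.
by rewrite lfunE /=; apply: subvs_inj; rewrite iterE !vsprojK ?(stableP _ _ (pow_stable _ phiW)).
Qed.

(** The inclusion matches subspaces of [subvs_of W] with subspaces of [V] inside [W], respecting the
    polar form and [phi]. *)
Lemma indecomposable_resE :
  orthogonally_indecomposable (res_quadform Q W) (res_lfun phi W) <-> indec Q phi W.
Proof.
have full0 : ({:subvs_of W}%VS != 0%VS) = (W != 0%VS).
  by rewrite -dimv_eq0 dimvf -(dimv_eq0 W).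
split=> [[W0 none]|[W0 Wmax]]; last first.
  split=> [|[X [/orthogonal_summandE[X0 ndX phiX] XW]]]; first by rewrite full0.
  have inX (u : subvs_of W) : (vsval u \in (incl @: X)%VS) = (u \in X).
    apply/memv_imgP/idP => [[v vX]|uX]; last by exists u; rewrite ?lfunE.
    by rewrite lfunE => /subvs_inj->.
  have sXW : (incl @: X <= W)%VS.
    by apply/subvP => _ /memv_imgP[u _ ->]; rewrite lfunE subvsP.
  case/eqP: XW; apply/vspaceP => u; rewrite memvf -inX (Wmax _ sXW) ?subvsP //.
  - apply/nondegP => _ /memv_imgP[u0 uX ->]; rewrite lfunE /= => /perpP up.
    rewrite (nondegP _ _ ndX u0 uX) ?linear0 //; apply/perpP => v vX.
    by rewrite res_qpolar up ?inX.
  - apply/stableP => _ /memv_imgP[u0 uX ->]; rewrite lfunE /= -res_lfunE inX.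
    by rewrite (stableP _ _ phiX).
  apply: contra X0 => /eqP X0; rewrite -subv0; apply/subvP => u0.
  by rewrite -inX X0 !memv0 => /eqP u00; apply/eqP/subvs_inj; rewrite u00 linear0.
split=> [|U sUW ndU phiU U0]; first by rewrite -full0.
apply/eqP/contraT => UW; case: none; exists (incl @^-1: U)%VS.
have inU (u : subvs_of W) : (u \in (incl @^-1: U)%VS) = (vsval u \in U).
  by rewrite -memv_preim lfunE.
have inU' x : x \in U -> vsval (vsproj W x) = x.
  by move=> xU; rewrite vsprojK // (subvP sUW).
split; last first.
  apply: contra UW => /eqP XW; rewrite eqEsubv sUW; apply/subvP => x xW.
  by rewrite -(vsprojK xW) -inU XW memvf.
apply/orthogonal_summandE; split.
- apply: contra U0 => /eqP X0; rewrite -subv0; apply/subvP => x xU.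
  have : vsproj W x \in (incl @^-1: U)%VS by rewrite inU inU'.
  by rewrite X0 !memv0 => /eqP px; rewrite -(inU' x xU) px linear0.
- apply/nondegP => u; rewrite inU => uU /perpP up; apply: subvs_inj; rewrite linear0.
  apply: (nondegP _ _ ndU) => //; apply/perpP => y yU.
  by rewrite -(inU' y yU) -res_qpolar up // inU inU'.
by apply/stableP => u; rewrite !inU res_lfunE => /(stableP _ _ phiU).
Qed.

Lemma good_summandE : nondeg Q W -> W != 0%VS ->
  good_summand Q phi W <-> unipotent (res_lfun phi W) /\
    (cyclic_transformation (res_lfun phi W) \/
     (orthogonally_indecomposable (res_quadform Q W) (res_lfun phi W) /\
      (\dim W = 2 %[mod 4])%N)).
Proof.
move=> ndW W0; rewrite /good_summand unipotent_resE cyclic_resE indecomposable_resE.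
by split=> [[]|[]].
Qed.

End StableSubspace.

End Restriction.

Unset Implicit Arguments.

Theorem theorem1p2 (K : fieldType) (charK : 2%N \in [pchar K])
    (V : vectType K) (Q : quadform V) (ndQ : nondefective Q) :
  ((4 <= \dim {:V})%N ->
     (bireflectional (special_orthogonal_group Q) <->
      (\dim {:V} = 0 %[mod 4])%N))
  /\
  ((\dim {:V} = 2 %[mod 4])%N ->
     forall phi : 'End(V), special_orthogonal_group Q phi ->
       (bireflectional_in (special_orthogonal_group Q) phi <->
        exists W : {vspace V},
          [/\ orthogonal_summand Q phi W,
              unipotent (res_lfun phi W)
            & cyclic_transformation (res_lfun phi W) \/
              (orthogonally_indecomposable (res_quadform Q W) (res_lfun phi W)
               /\ (\dim W = 2 %[mod 4])%N)])).
Proof.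
have ndV : nondeg Q {:V} by rewrite -nondefectiveE.
split=> [dV|dV phi [[_ phiQ] phi_even]].
  split=> [biref|dV0 phi [[_ phiQ] phi_even]].
    (* Without fixed vectors the shift of [g] is the whole, even, dimension, so [g] lies in the
       special orthogonal group. *)
    have [g gQ gker] := fixed_point_free_isometry charK ndV dV.
    apply: (not_bireflectional charK ndV gQ gker); apply: biref.
    have gE : shift g {:V} = \dim {:V} by rewrite /shift limg_dim_eq // gker capv0.
    by apply: SO_intro => //; rewrite gE (even_dim_nd charK ndV).
  apply: bireflectional_of_parity => //.
  have -> : false = odd (\dim {:V})./2 by move: dV0; move: (\dim _) => n; clear; lia.
  by apply: split_parity_exists => //; apply: subvf.
split=> [/(bireflectional_good charK ndV phiQ dV)[W goodW]|[W]].
  have [W0 ndW phiW _ _] := goodW; exists W.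
  have [unipW typeW] := (good_summandE phiW ndW W0).1 goodW.
  by split=> //; apply/orthogonal_summandE.
case=> /orthogonal_summandE[W0 ndW phiW] unipW typeW.
apply: (good_bireflectional charK ndV phiQ phi_even (U := W)).
exact/(good_summandE phiW ndW W0).
Qed.
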